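(* Let $G$ be a finitely generated group. Then (1) ${K_G}'$ and $K_G/\sqrt{K_G}$ are locally finite; (2) if $G$ has no nontrivial locally finite normal subgroup then $K_G$ is torsion-free abelian; (3) if $C_G(H)$ is finite for all normal subgroups $H$ of finite index in $G$ then $K_G$ and $K_{aut}(G)$ are locally finite; (4) if $G$ has no infinite elementary amenable normal subgroup then $K_G$ is the maximal finite normal subgroup of $G$, and $Comm(G)$ maps injectively to $Comm(G/K_G)$.
   Context: The abstract commensurator $Comm(G)$ of a group $G$ is the group of equivalence classes of isomorphisms $\alpha:H\cong J$ between subgroups $H,J$ of finite index in $G$, where $\alpha$ and $\alpha'$ are equivalent if they agree on some common subgroup of finite index, and the product of the classes of $\alpha$ and $\beta$ is represented by the partially defined composite $\alpha\circ\beta$. Conjugation in $G$ determines a natural homomorphism $G\to Comm(G)$, and $K_G$ denotes its kernel. $K_{aut}(G)$ denotes the kernel of the natural homomorphism from $Aut(G)$ to $Comm(G)$ (sending an automorphism to its class). $C_G(H)$ is the centralizer of $H$ in $G$; $K'$ is the commutator subgroup of $K$; $\sqrt{K}$ is the Hirsch-Plotkin radical of $K$, i.e. its maximal locally nilpotent normal subgroup. A group is locally finite if all its finitely generated subgroups are finite. The class of elementary amenable groups is the smallest class of groups containing all finite groups and all abelian groups and closed under subgroups, quotients, extensions and directed unions. The map $Comm(G)\to Comm(G/K_G)$ in (4) is the natural one: an isomorphism $f:H\to J$ between finite index subgroups of $G$ restricts to an isomorphism $H\cap K_G\to J\cap K_G$, hence induces an isomorphism $\overline{f}:H/(H\cap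 K_G)\to J/(J\cap K_G)$ between finite index subgroups of $G/K_G$, and the class $[f]$ is sent to $[\overline{f}]$. *)

(* Defs.v *)
From HB Require Import structures.
From mathcomp Require Import all_boot all_classical.

Set Implicit Arguments.
Unset Strict Implicit.
Unset Printing Implicit Defensive.

Local Open Scope classical_set_scope.
Local Open Scope quotient_scope.
Local Open Scope group_scope.

Definition is_subgroup (G : groupType) (S : set G) : Prop :=
  [/\ S 1, forall x y, S x -> S y -> S (x * y) & forall x, S x -> S x^-1].

Record subgroup (G : groupType) := Subgroup {
  sgset :> set G;
  sgP : is_subgroup sgset }.

Identity Coercion set_to_fun : set >-> Funclass.

Section SubgroupLemmas.
Variables (G : groupType) (H : subgroup G).

Lemma sg1 : H 1. Proof. by case: (sgP H). Qed.
Lemma sgM x y : H x -> H y -> H (x * y). Proof. by case: (sgP H) => _ + _; exact. Qed.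
Lemma sgV x : H x -> H x^-1. Proof. by case: (sgP H) => _ _; exact. Qed.

End SubgroupLemmas.

Lemma subgroup_closed (G : groupType) (H : subgroup G) :
  group_closed (fun x => x \in sgset H).
Proof.
split=> [|x y Hx Hy]; first exact/mem_set/sg1.
by apply/mem_set/sgM; [exact: set_mem Hx | apply/sgV; exact: set_mem Hy].
Qed.

Definition subg_type (G : groupType) (H : subgroup G) := {x : G | x \in sgset H}.

HB.instance Definition _ (G : groupType) (H : subgroup G) :=
  SubChoice.on (subg_type H).
HB.instance Definition _ (G : groupType) (H : subgroup G) :=
  SubChoice_isSubGroup.Build G _ (subg_type H) (subgroup_closed H).

Coercion subgroup_group (G : groupType) (H : subgroup G) : groupType :=
  subg_type H.

Record nsubgroup (G : groupType) := NSubgroup {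
  nsubg :> subgroup G;
  nsubgJ : forall x y, nsubg x -> nsubg (x ^ y) }.

Section SubgroupConstructions.
Variable G : groupType.
Implicit Types H K : subgroup G.

Lemma subgT_proof : is_subgroup [set: G]. Proof. by []. Qed.
Definition subgT := Subgroup subgT_proof.

Lemma subgI_proof H K : is_subgroup (H `&` K).
Proof.
split; first by split; exact: sg1.
- by move=> x y [? ?] [? ?]; split; exact: sgM.
- by move=> x [? ?]; split; exact: sgV.
Qed.
Definition subgI H K := Subgroup (subgI_proof H K).

Lemma generated_proof (S : set G) :
  is_subgroup [set x | forall H : subgroup G, S `<=` H -> H x].
Proof.
split=> [H _|x y Sx Sy H SH|x Sx H SH]; first exact: sg1.
- by apply: sgM; [exact: Sx|exact: Sy].
- by apply: sgV; exact: Sx.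
Qed.
Definition generated (S : set G) := Subgroup (generated_proof S).

Lemma centralizer_proof (S : set G) :
  is_subgroup [set x | forall y, S y -> commute x y].
Proof.
split=> [y _|x y Sx Sy z Sz|x Sx z Sz]; first exact/commute_sym/commute1.
- by apply/commute_sym/commuteM; apply/commute_sym; [exact: Sx|exact: Sy].
- apply: (mulgI x); apply: (mulIg x).
  by rewrite mulVKg -!mulgA mulVg mulg1 Sx.
Qed.
Definition centralizer (S : set G) := Subgroup (centralizer_proof S).

End SubgroupConstructions.

Definition derived (G : groupType) : subgroup G :=
  generated [set z | exists x y : G, z = [~ x, y]].

Section Kernel.
Variables (G K : groupType) (f : UMagmaMorphism.type G K).

Lemma kernel_proof : is_subgroup [set x | f x = 1].
Proof.
split=> [|x y /= fx fy|x /= fx]; first exact: gmulf1.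
- by rewrite gmulfM fx fy mulg1.
- by rewrite gmulfV fx invg1.
Qed.
Lemma kernelJ x y : Subgroup kernel_proof x -> Subgroup kernel_proof (x ^ y).
Proof. by move=> /= fx; rewrite gmulfJ fx conj1g. Qed.
Definition kernel := NSubgroup kernelJ.

End Kernel.

Definition lcoset (G : groupType) (x : G) (H : set G) : set G :=
  [set x * h | h in H].

Definition finite_index (G : groupType) (H : subgroup G) : Prop :=
  finite_set [set lcoset x H | x in [set: G]].

Section FiniteIndex.
Variable G : groupType.
Implicit Types H K : subgroup G.

Lemma lcosetP H x y : lcoset x H y <-> H (x^-1 * y).
Proof.
split=> [[h Hh <-]|Hxy]; first by rewrite mulKg.
by exists (x^-1 * y); rewrite ?mulVKg.
Qed.

Lemma subg_sym H x y : H (x^-1 * y) -> H (y^-1 * x).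
Proof. by move=> /sgV; rewrite invgM invgK. Qed.

Lemma subg_trans H x y z : H (x^-1 * y) -> H (y^-1 * z) -> H (x^-1 * z).
Proof. by move=> Hx Hy; have := sgM Hx Hy; rewrite mulgA mulgK. Qed.

Lemma lcoset_eq H x y : H (x^-1 * y) -> lcoset x H = lcoset y H.
Proof.
move=> Hxy; apply/seteqP; split=> z /lcosetP Hz; apply/lcosetP.
  exact: subg_trans (subg_sym Hxy) Hz.
exact: subg_trans Hxy Hz.
Qed.

Lemma finite_indexP H : finite_index H <->
  exists s : seq G, forall x, exists2 t, t \in s & H (t^-1 * x).
Proof.
split=> [/finite_seqP[s Hs]|[s Hs]].
  exists [seq xget 1 C | C : set G <- s] => x.
  have sx : lcoset x H \in s.
    have : [set lcoset x H | x in [set: G]] (lcoset x H) by exists x.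
    by rewrite Hs.
  exists (xget 1 (lcoset x H)); first exact: map_f.
  have /lcosetP : lcoset x H (xget 1 (lcoset x H)).
    by apply: (@xgetPex _ 1); exists x; apply/lcosetP; rewrite mulVg; exact: sg1.
  exact: subg_sym.
apply: (@sub_finite_set _ _ [set lcoset x H | x in [set` s]]).
  by move=> _ [x _ <-]; have [t st Ht] := Hs x; exists t => //; exact: lcoset_eq.
exact/finite_image/finite_seq.
Qed.

Lemma finite_indexT : finite_index (subgT G).
Proof. by apply/finite_indexP; exists [:: 1] => x; exists 1; rewrite ?inE. Qed.

Lemma finite_indexS H K : H `<=` K -> finite_index H -> finite_index K.
Proof.
move=> HK /finite_indexP[s Hs]; apply/finite_indexP; exists s => x.
by have [t st /HK] := Hs x; exists t.
Qed.

Lemma finite_indexI H K :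
  finite_index H -> finite_index K -> finite_index (subgI H K).
Proof.
move=> fH fK.
apply: sub_finite_set (finite_image2 (fun A B : set G => A `&` B) fH fK).
move=> _ [x _ <-]; exists (lcoset x H); first by exists x.
exists (lcoset x K); first by exists x.
apply/seteqP; split=> z.
  by move=> [/lcosetP Hz /lcosetP Kz]; apply/lcosetP.
by move=> /lcosetP[Hz Kz]; split; apply/lcosetP.
Qed.

End FiniteIndex.

Section Quotient.
Variables (G : groupType) (N : nsubgroup G).

Definition quot_rel : rel G := fun x y => `[< N (x^-1 * y) >].

Lemma quot_rel_refl : reflexive quot_rel.
Proof. by move=> x; apply/asboolP; rewrite mulVg; exact: sg1. Qed.
Lemma quot_rel_sym : symmetric quot_rel.
Proof. by move=> x y; apply/asboolP/asboolP; exact: subg_sym. Qed.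
Lemma quot_rel_trans : transitive quot_rel.
Proof.
by move=> y x z /asboolP ? /asboolP ?; apply/asboolP; exact: (@subg_trans _ _ x y z).
Qed.

Canonical quot_equiv := EquivRel quot_rel quot_rel_refl quot_rel_sym quot_rel_trans.

Definition quotg := {eq_quot quot_rel}.
HB.instance Definition _ := Choice.on quotg.

Definition quot_proj (x : G) : quotg := \pi_{eq_quot quot_rel} x.

Lemma quot_projP x y : quot_proj x = quot_proj y <-> N (x^-1 * y).
Proof.
split=> [/eqmodP/asboolP //|Nxy]; exact/eqmodP/asboolP.
Qed.

Definition quot_repr (q : quotg) : G := repr q.

Lemma quot_reprK q : quot_proj (quot_repr q) = q.
Proof. exact: reprK. Qed.

Definition quot_mul (p q : quotg) := quot_proj (quot_repr p * quot_repr q).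
Definition quot_inv (p : quotg) := quot_proj (quot_repr p)^-1.

Lemma quot_projM x y : quot_proj (x * y) = quot_mul (quot_proj x) (quot_proj y).
Proof.
apply/quot_projP; have /quot_projP/subg_sym Nx := quot_reprK (quot_proj x).
have /quot_projP/subg_sym Ny := quot_reprK (quot_proj y).
have := sgM (nsubgJ y Nx) Ny; congr (sgset _ _).
by rewrite /conjg invgM !mulgA mulgK.
Qed.

Lemma quot_projV x : quot_proj x^-1 = quot_inv (quot_proj x).
Proof.
apply/quot_projP; have /quot_projP/subg_sym Nx := quot_reprK (quot_proj x).
have := nsubgJ x^-1 (subg_sym Nx); congr (sgset _ _).
by rewrite /conjg !invgK !mulgA mulgK.
Qed.

Lemma quot_mulA : associative quot_mul.
Proof.
move=> p q r; rewrite -(quot_reprK p) -(quot_reprK q) -(quot_reprK r).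
by rewrite -!quot_projM mulgA.
Qed.
Lemma quot_mul1 : left_id (quot_proj 1) quot_mul.
Proof. by move=> p; rewrite -(quot_reprK p) -quot_projM mul1g. Qed.
Lemma quot_mulr1 : right_id (quot_proj 1) quot_mul.
Proof. by move=> p; rewrite -(quot_reprK p) -quot_projM mulg1. Qed.
Lemma quot_mulV : left_inverse (quot_proj 1) quot_inv quot_mul.
Proof.
by move=> p; rewrite -(quot_reprK p) -quot_projV -quot_projM mulVg.
Qed.
Lemma quot_mulrV : right_inverse (quot_proj 1) quot_inv quot_mul.
Proof.
by move=> p; rewrite -(quot_reprK p) -quot_projV -quot_projM mulgV.
Qed.

HB.instance Definition _ := isGroup.Build quotg
  quot_mulA quot_mul1 quot_mulr1 quot_mulV quot_mulrV.

Lemma quot_proj_morph : monoid_morphism quot_proj.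
Proof. by split=> // x y; exact: quot_projM. Qed.

HB.instance Definition _ := isUMagmaMorphism.Build G quotg quot_proj quot_proj_morph.

End Quotient.

Definition finitely_generated (G : groupType) : Prop :=
  exists2 S : set G, finite_set S & generated S = [set: G] :> set G.

Definition finite_group (G : groupType) : Prop := finite_set [set: G].

Definition is_abelian (G : groupType) : Prop := forall x y : G, commute x y.

Definition torsion_free (G : groupType) : Prop :=
  forall (x : G) (n : nat), x ^+ n.+1 = 1 -> x = 1.

Fixpoint lower_central (G : groupType) (n : nat) : subgroup G :=
  if n is m.+1 then
    generated [set z | exists x y : G, lower_central G m x /\ z = [~ x, y]]
  else subgT G.

Definition nilpotent (G : groupType) : Prop :=
  exists n, lower_central G n = [set 1] :> set G.

Definition locally (P : groupType -> Prop) (G : groupType) : Prop :=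
  forall H : subgroup G, finitely_generated H -> P H.

Definition locally_finite : groupType -> Prop := locally finite_group.

Definition locally_nilpotent : groupType -> Prop := locally nilpotent.

(* "The maximal" normal subgroup with a property is the one containing all    *)
(* the others.                                                                *)
Definition is_maximal_normal (P : groupType -> Prop) (G : groupType)
    (R : nsubgroup G) : Prop :=
  P R /\ forall N : nsubgroup G, P N -> N `<=` R.

Definition is_hirsch_plotkin_radical : forall G : groupType, nsubgroup G -> Prop :=
  is_maximal_normal locally_nilpotent.

(* The morphisms in [EA_sub] and [EA_quo] make the class isomorphism-closed.  *)
Inductive elementary_amenable : groupType -> Prop :=
| EA_finite (G : groupType) : finite_group G -> elementary_amenable G
| EA_abelian (G : groupType) : is_abelian G -> elementary_amenable G
| EA_sub (G H : groupType) (f : {multiplicative H -> G}) :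
    injective f -> elementary_amenable G -> elementary_amenable H
| EA_quo (G Q : groupType) (f : {multiplicative G -> Q}) :
    (forall q, exists x, f x = q) ->
    elementary_amenable G -> elementary_amenable Q
| EA_ext (G : groupType) (N : nsubgroup G) :
    elementary_amenable N -> elementary_amenable (quotg N) ->
    elementary_amenable G
| EA_union (G : groupType) (F : set (subgroup G)) :
    (forall H K, F H -> F K -> exists2 L, F L & H `<=` L /\ K `<=` L) ->
    (forall x, exists2 H, F H & sgset H x) ->
    (forall H, F H -> elementary_amenable H) ->
    elementary_amenable G.

(* An isomorphism vdom -> vcod between subgroups of finite index; the values  *)
(* of vfun outside vdom are junk, ignored by [veq] below.                     *)
Record viso (G : groupType) := Viso {
  vdom : subgroup G;
  vcod : subgroup G;
  vfun :> G -> G;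
  vdom_fin : finite_index vdom;
  vcod_fin : finite_index vcod;
  vfunM : forall x y, vdom x -> vdom y -> vfun (x * y) = vfun x * vfun y;
  vfun_bij : set_bij vdom vcod vfun }.

Definition veq (G : groupType) (f g : viso G) : Prop :=
  exists L : subgroup G, [/\ finite_index L, L `<=` vdom f `&` vdom g &
    forall x, L x -> f x = g x].

Section PartialInverse.
Variables (G K : groupType).

Definition inv_on (D : set G) (f : G -> K) (y : K) : G :=
  xget 1 [set x | D x /\ f x = y].

Lemma inv_onP (D : set G) f y :
  [set f x | x in D] y -> D (inv_on D f y) /\ f (inv_on D f y) = y.
Proof. by move=> [x Dx fx]; apply: (@xgetPex _ 1 [set x | D x /\ f x = y]); exists x. Qed.

End PartialInverse.

Section VisoTheory.
Variable G : groupType.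
Implicit Types f g h : viso G.

Lemma vM f x y : vdom f x -> vdom f y -> f (x * y) = f x * f y.
Proof. exact: vfunM. Qed.

Lemma v1 f : f 1 = 1.
Proof. by apply: (mulgI (f 1)); rewrite -vM ?mulg1 //; exact: sg1. Qed.

Lemma vV f x : vdom f x -> f x^-1 = (f x)^-1.
Proof.
move=> Dx; apply: (mulgI (f x)); rewrite mulgV -vM ?mulgV ?v1 //; exact: sgV.
Qed.

Lemma v_cod f x : vdom f x -> vcod f (f x).
Proof. by have [fD _ _] := vfun_bij f => /fD. Qed.

Lemma v_inj f x y : vdom f x -> vdom f y -> f x = f y -> x = y.
Proof.
by have [_ fI _] := vfun_bij f => Dx Dy; apply: fI; exact: mem_set.
Qed.

Lemma v_surj f y : vcod f y -> exists2 x, vdom f x & f x = y.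
Proof. by have [_ _ fS] := vfun_bij f => /fS. Qed.

Lemma vimage_proof f (L : subgroup G) : is_subgroup [set f x | x in vdom f `&` L].
Proof.
split; first by exists 1; [split; exact: sg1|exact: v1].
- move=> _ _ [x [Dx Lx] <-] [y [Dy Ly] <-].
  by exists (x * y); [split; exact: sgM|exact: vM].
- by move=> _ [x [Dx Lx] <-]; exists x^-1; [split; exact: sgV|exact: vV].
Qed.
Definition vimage f L := Subgroup (vimage_proof f L).

Lemma vimage_fin f L : finite_index L -> finite_index (vimage f L).
Proof.
move=> fL; have /finite_indexP[s Hs] := finite_indexI (vdom_fin f) fL.
have /finite_indexP[t Ht] := vcod_fin f.
apply/finite_indexP; exists [seq b * f a | b <- t, a <- s] => x.
have [b tb /v_surj[y Dy fy]] := Ht x; have [a sa [Da La]] := Hs y.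
have Da' : vdom f a.
  by have := sgM Dy (sgV Da); rewrite invgM invgK mulVKg.
exists (b * f a); first exact: allpairs_f.
exists (a^-1 * y) => //; rewrite vM ?vV //; last exact: sgV.
by rewrite fy invgM mulgA.
Qed.

Lemma inv_onK f x : vdom f x -> inv_on (vdom f) f (f x) = x.
Proof.
move=> Dx; have [|D E] := @inv_onP _ _ (vdom f) f (f x); first by exists x.
exact: v_inj E.
Qed.

Lemma vinvM f x y : vcod f x -> vcod f y ->
  inv_on (vdom f) f (x * y) = inv_on (vdom f) f x * inv_on (vdom f) f y.
Proof.
move=> /v_surj[a Da <-] /v_surj[b Db <-].
by rewrite -vM // !inv_onK //; exact: sgM.
Qed.

Lemma vinv_bij f : set_bij (vcod f) (vdom f) (inv_on (vdom f) f).
Proof.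
split=> [_ /v_surj[a Da <-]|x y /set_mem /v_surj[a Da <-] /set_mem /v_surj[b Db <-]|x Dx].
- by rewrite /= inv_onK.
- by rewrite !inv_onK // => ->.
- by exists (f x); [exact: v_cod|exact: inv_onK].
Qed.

Definition vinv f := Viso (vcod_fin f) (vdom_fin f) (@vinvM f) (vinv_bij f).

Lemma vinvK f x : vdom f x -> vinv f (f x) = x.
Proof. exact: inv_onK. Qed.

Lemma vinvKV f y : vcod f y -> f (vinv f y) = y.
Proof. by move=> /v_surj[x Dx <-]; rewrite vinvK. Qed.

Lemma vinv_dom f y : vcod f y -> vdom f (vinv f y).
Proof. by move=> /v_surj[x Dx <-]; rewrite vinvK. Qed.

Lemma vpreim_proof f (L : subgroup G) : is_subgroup (vdom f `&` f @^-1` L).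
Proof.
split; first by split; [|rewrite /= v1]; exact: sg1.
- by move=> x y [Dx Lx] [Dy Ly]; split; [|rewrite /= vM //]; exact: sgM.
- by move=> x [Dx Lx]; split; [|rewrite /= vV //]; exact: sgV.
Qed.
Definition vpreim f L := Subgroup (vpreim_proof f L).

Lemma vpreim_fin f L : finite_index L -> finite_index (vpreim f L).
Proof.
move=> /(vimage_fin (vinv f)); apply: finite_indexS.
by move=> _ [y [Dy Ly] <-]; split; [exact: vinv_dom|rewrite /= vinvKV].
Qed.

Lemma vcompM f g x y : vpreim g (vdom f) x -> vpreim g (vdom f) y ->
  (f \o g) (x * y) = (f \o g) x * (f \o g) y.
Proof. by move=> [gx fx] [gy fy]; rewrite /= !vM. Qed.

Lemma vcomp_bij f g :
  set_bij (vpreim g (vdom f)) (vimage f (vcod g)) (f \o g).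
Proof.
split=> [x [gx fx]|x y /set_mem [gx fx] /set_mem [gy fy] /= E|].
- by exists (g x) => //; split=> //; exact: v_cod.
- exact: (v_inj gx gy (v_inj fx fy E)).
- by move=> _ [y [fy /v_surj[x gx gxy]] <-]; exists x; rewrite /= ?gxy //; split; rewrite /= ?gxy.
Qed.

(* the partially defined composite, g first *)
Definition vcomp f g := Viso (vpreim_fin g (vdom_fin f))
  (vimage_fin f (vcod_fin g)) (@vcompM f g) (vcomp_bij f g).

Lemma veq_refl f : veq f f.
Proof. by exists (vdom f); split=> //; exact: vdom_fin. Qed.

Lemma veq_sym f g : veq f g -> veq g f.
Proof.
by move=> [L [fL LD E]]; exists L; split=> // x Lx; [have [] := LD _ Lx|rewrite E].
Qed.

Lemma veq_trans f g h : veq f g -> veq g h -> veq f h.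
Proof.
move=> [L [fL LD E]] [M [fM MD F]]; exists (subgI L M); split.
- exact: finite_indexI.
- by move=> x [/LD[? _] /MD[_ ?]].
- by move=> x [Lx Mx]; rewrite E ?F.
Qed.

Lemma veq_comp f f' g g' : veq f f' -> veq g g' -> veq (vcomp f g) (vcomp f' g').
Proof.
move=> [L [fL LD E]] [M [fM MD F]].
exists (subgI M (vpreim g L)); split.
- by apply: finite_indexI => //; exact: vpreim_fin.
- move=> x [Mx [gx Lx]]; have [fgx fgx'] := LD _ Lx; split; split=> //=.
  + by have [] := MD _ Mx.
  + by rewrite -F.
- by move=> x [Mx [gx Lx]] /=; rewrite -F // E.
Qed.

Lemma veq_inv f f' : veq f f' -> veq (vinv f) (vinv f').
Proof.
move=> [L [fL LD E]]; exists (vimage f L); split; first exact: vimage_fin.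
- move=> _ [x [fx Lx] <-]; have [_ fx'] := LD _ Lx; split; first exact: v_cod.
  by rewrite E //; exact: v_cod.
- move=> _ [x [fx Lx] <-]; have [_ fx'] := LD _ Lx.
  by rewrite vinvK // E // vinvK.
Qed.

End VisoTheory.

HB.instance Definition _ (G : groupType) := gen_eqMixin (viso G).
HB.instance Definition _ (G : groupType) := gen_choiceMixin (viso G).

Record aut (G : groupType) := Aut {
  autfun :> G -> G;
  autM : {morph autfun : x y / x * y};
  aut_bij : bijective autfun }.

HB.instance Definition _ (G : groupType) := gen_eqMixin (aut G).
HB.instance Definition _ (G : groupType) := gen_choiceMixin (aut G).

Section AutGroup.
Variable G : groupType.
Implicit Types a b : aut G.

Lemma aut_eqP a b : a =1 b -> a = b.
Proof.
case: a b => [f fM fB] [g gM gB] /= /funext E; case: _ / E gM gB => gM gB.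
by congr Aut; exact: Prop_irrelevance.
Qed.

Definition aut1 : aut G := @Aut G id (fun _ _ => erefl) (Bijective (fun=> erefl) (fun=> erefl)).

Lemma aut_mul_morph a b : {morph a \o b : x y / x * y}.
Proof. by move=> x y /=; rewrite !autM. Qed.
Definition aut_mul a b : aut G :=
  Aut (@aut_mul_morph a b) (bij_comp (aut_bij a) (aut_bij b)).

Lemma aut_invK a : cancel a (inv_on setT a).
Proof.
move=> x; have [|_] := @inv_onP _ _ setT a (a x); first by exists x.
exact: (bij_inj (aut_bij a)).
Qed.

Lemma aut_invKV a : cancel (inv_on setT a) a.
Proof.
move=> y; have [g _ gK] := aut_bij a.
by have [|_] := @inv_onP _ _ setT a y; first by exists (g y).
Qed.

Lemma aut_inv_morph a : {morph inv_on setT a : x y / x * y}.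
Proof.
move=> x y; apply: (bij_inj (aut_bij a)).
by rewrite autM !aut_invKV.
Qed.
Definition aut_inv a : aut G :=
  Aut (@aut_inv_morph a) (Bijective (@aut_invKV a) (@aut_invK a)).

Lemma aut_mulA : associative aut_mul. Proof. by move=> a b c; exact: aut_eqP. Qed.
Lemma aut_mul1 : left_id aut1 aut_mul. Proof. by move=> a; exact: aut_eqP. Qed.
Lemma aut_mulr1 : right_id aut1 aut_mul. Proof. by move=> a; exact: aut_eqP. Qed.
Lemma aut_mulV : left_inverse aut1 aut_inv aut_mul.
Proof. by move=> a; apply: aut_eqP => x; exact: aut_invK. Qed.
Lemma aut_mulrV : right_inverse aut1 aut_inv aut_mul.
Proof. by move=> a; apply: aut_eqP => x; exact: aut_invKV. Qed.

HB.instance Definition _ := isGroup.Build (aut G)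
  aut_mulA aut_mul1 aut_mulr1 aut_mulV aut_mulrV.

Lemma aut1E x : (1 : aut G) x = x. Proof. by []. Qed.
Lemma autME a b x : (a * b) x = a (b x). Proof. by []. Qed.

Lemma aut_visoM a x y : subgT G x -> subgT G y -> a (x * y) = a x * a y.
Proof. by move=> _ _; exact: autM. Qed.
Lemma aut_viso_bij a : set_bij (subgT G) (subgT G) a.
Proof.
split=> // [x y _ _|y _]; first exact: (bij_inj (aut_bij a)).
by have [g _ gK] := aut_bij a; exists (g y).
Qed.
Definition aut_viso a : viso G :=
  Viso (finite_indexT G) (finite_indexT G) (@aut_visoM a) (aut_viso_bij a).

(* x ^ g^-1 is g x g^-1; with x ^ g instead, conj_aut would reverse products  *)
Definition conj_aut (g : G) : aut G := @Aut G (fun x => x ^ g^-1)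
  (fun x y => conjMg x y g^-1) (Bijective (@conjgKV G g) (@conjgK G g)).

Lemma conj_autM g h : conj_aut (g * h) = conj_aut g * conj_aut h.
Proof. by apply: aut_eqP => x; rewrite autME /= invgM conjgM. Qed.

End AutGroup.

Section Commensurator.
Variable G : groupType.
Implicit Types f g h : viso G.

Definition veqb : rel (viso G) := fun f g => `[< veq f g >].

Lemma veqb_refl : reflexive veqb.
Proof. by move=> f; apply/asboolP; exact: veq_refl. Qed.
Lemma veqb_sym : symmetric veqb.
Proof. by move=> f g; apply/asboolP/asboolP; exact: veq_sym. Qed.
Lemma veqb_trans : transitive veqb.
Proof. by move=> g f h /asboolP ? /asboolP ?; apply/asboolP; exact: (@veq_trans _ f g h). Qed.

Canonical veqb_equiv := EquivRel veqb veqb_refl veqb_sym veqb_trans.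

Definition Comm := {eq_quot veqb}.
HB.instance Definition _ := Choice.on Comm.

Definition comm_class f : Comm := \pi_{eq_quot veqb} f.
Definition comm_repr (c : Comm) : viso G := repr c.

Lemma comm_reprK c : comm_class (comm_repr c) = c.
Proof. exact: reprK. Qed.

Lemma comm_classP f g : comm_class f = comm_class g <-> veq f g.
Proof. split=> [/eqmodP/asboolP //|Efg]; exact/eqmodP/asboolP. Qed.

Lemma veq_repr f : veq (comm_repr (comm_class f)) f.
Proof. exact/comm_classP/comm_reprK. Qed.

Definition comm_one := comm_class (aut_viso (aut1 G)).
Definition comm_mul c d := comm_class (vcomp (comm_repr c) (comm_repr d)).
Definition comm_inv c := comm_class (vinv (comm_repr c)).

Lemma comm_mul_class f g :
  comm_mul (comm_class f) (comm_class g) = comm_class (vcomp f g).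
Proof. by apply/comm_classP/veq_comp; exact: veq_repr. Qed.

Lemma comm_inv_class f : comm_inv (comm_class f) = comm_class (vinv f).
Proof. by apply/comm_classP/veq_inv; exact: veq_repr. Qed.

Lemma comm_mulA : associative comm_mul.
Proof.
move=> c d e; rewrite -(comm_reprK c) -(comm_reprK d) -(comm_reprK e).
rewrite !comm_mul_class; apply/comm_classP.
set f := comm_repr c; set g := comm_repr d; set h := comm_repr e.
exists (vdom (vcomp f (vcomp g h))); split=> //; first exact: vdom_fin.
by move=> x [[hx gx] fx]; split; split.
Qed.

Lemma comm_mul1 : left_id comm_one comm_mul.
Proof.
move=> c; rewrite -(comm_reprK c) comm_mul_class; apply/comm_classP.
by exists (vdom (comm_repr c)); split=> //; exact: vdom_fin.
Qed.

Lemma comm_mulr1 : right_id comm_one comm_mul.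
Proof.
move=> c; rewrite -(comm_reprK c) comm_mul_class; apply/comm_classP.
by exists (vdom (comm_repr c)); split=> //; exact: vdom_fin.
Qed.

Lemma comm_mulV : left_inverse comm_one comm_inv comm_mul.
Proof.
move=> c; rewrite -(comm_reprK c) comm_inv_class comm_mul_class.
apply/comm_classP; exists (vdom (comm_repr c)); split; first exact: vdom_fin.
  by move=> x cx; split=> //; split=> //; exact: v_cod.
by move=> x cx /=; exact: vinvK.
Qed.

Lemma comm_mulrV : right_inverse comm_one comm_inv comm_mul.
Proof.
move=> c; rewrite -(comm_reprK c) comm_inv_class comm_mul_class.
apply/comm_classP; exists (vcod (comm_repr c)); split; first exact: vcod_fin.
  by move=> x cx; split=> //; split=> //; exact: vinv_dom.
by move=> x cx /=; exact: vinvKV.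
Qed.

HB.instance Definition _ := isGroup.Build Comm
  comm_mulA comm_mul1 comm_mulr1 comm_mulV comm_mulrV.

Lemma comm_classM f g : comm_class f * comm_class g = comm_class (vcomp f g).
Proof. exact: comm_mul_class. Qed.

Definition aut_comm (a : aut G) : Comm := comm_class (aut_viso a).

Lemma aut_comm_morph : monoid_morphism aut_comm.
Proof.
split=> // a b; rewrite comm_classM; apply/comm_classP.
by exists (subgT G); split=> //; exact: finite_indexT.
Qed.

HB.instance Definition _ :=
  isUMagmaMorphism.Build (aut G) Comm aut_comm aut_comm_morph.

Definition conj_comm (g : G) : Comm := aut_comm (conj_aut g).

Lemma conj_comm_morph : monoid_morphism conj_comm.
Proof.
split=> [|g h]; last by rewrite /conj_comm conj_autM gmulfM.
rewrite -[RHS](gmulf1 (s := aut_comm : UMagmaMorphism.type _ _)); congr aut_comm.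
by apply: aut_eqP => x; rewrite /= invg1 conjg1.
Qed.

HB.instance Definition _ :=
  isUMagmaMorphism.Build G Comm conj_comm conj_comm_morph.

Definition conj_kernel : nsubgroup G := kernel conj_comm.

Definition aut_kernel : nsubgroup (aut G) := kernel aut_comm.

End Commensurator.

Section CommQuotient.
Variable G : groupType.
Implicit Types f g : viso G.
Local Notation K := (conj_kernel G).
Local Notation pi := (@quot_proj G K).

Lemma conj_kernelP x :
  K x <-> exists2 L : subgroup G, finite_index L & forall y, L y -> commute x y.
Proof.
split=> [/comm_classP[L [fL _ E]]|[L fL E]].
  exists L => // y /E /= /(congr1 (fun z => z * x)).
  by rewrite /conjg invgK mulgA mulgVK.
apply/comm_classP; exists L; split=> // y /E Exy /=.
by rewrite /conjg invgK mulgA Exy mulgK.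
Qed.

Lemma viso_conj_kernel f x : vdom f x -> K x -> K (f x).
Proof.
move=> Dx /conj_kernelP[L fL E]; apply/conj_kernelP.
exists (vimage f L); first exact: vimage_fin.
by move=> _ [y [Dy Ly] <-]; rewrite /commute -!vM // E.
Qed.

Lemma viso_quot f x y :
  vdom f x -> vdom f y -> (pi (f x) = pi (f y) <-> pi x = pi y).
Proof.
have main (g : viso G) a b : vdom g a -> vdom g b -> pi a = pi b -> pi (g a) = pi (g b).
  move=> Da Db /quot_projP Kab; apply/quot_projP.
  by rewrite -vV // -vM //; [apply: viso_conj_kernel => //; apply: sgM => //|]; exact: sgV.
move=> Dx Dy; split; last exact: main.
move=> /(@main (vinv f) _ _ (v_cod Dx) (v_cod Dy)).
by rewrite !vinvK.
Qed.

Lemma quot_image_proof (H : subgroup G) : is_subgroup [set pi x | x in H].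
Proof.
split; first by exists 1; [exact: sg1|exact: gmulf1].
- by move=> _ _ [x Hx <-] [y Hy <-]; exists (x * y); [exact: sgM|exact: gmulfM].
- by move=> _ [x Hx <-]; exists x^-1; [exact: sgV|exact: gmulfV].
Qed.
Definition quot_image (H : subgroup G) := Subgroup (quot_image_proof H).

Lemma quot_image_fin H : finite_index H -> finite_index (quot_image H).
Proof.
move=> /finite_indexP[s Hs]; apply/finite_indexP; exists (map pi s) => q.
rewrite -(quot_reprK q); have [t st Ht] := Hs (quot_repr q).
exists (pi t); first exact: map_f.
by exists (t^-1 * quot_repr q) => //; rewrite gmulfM gmulfV.
Qed.

(* f x K_G as a function of x K_G, for x in vdom f.  The subgroup             *)
(* H / (H :&: K_G) is identified with the image H K_G / K_G of H.             *)
Definition quot_fun f (q : quotg K) : quotg K := pi (f (inv_on (vdom f) pi q)).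

Lemma quot_funE f x : vdom f x -> quot_fun f (pi x) = pi (f x).
Proof.
move=> Dx; have [|D E] := @inv_onP _ _ (vdom f) pi (pi x); first by exists x.
exact/viso_quot.
Qed.

Lemma quot_visoM f p q : quot_image (vdom f) p -> quot_image (vdom f) q ->
  quot_fun f (p * q) = quot_fun f p * quot_fun f q.
Proof.
move=> [x Dx <-] [y Dy <-].
by rewrite -gmulfM !quot_funE ?vM ?gmulfM //; exact: sgM.
Qed.

Lemma quot_viso_bij f :
  set_bij (quot_image (vdom f)) (quot_image (vcod f)) (quot_fun f).
Proof.
split.
- by move=> _ [x Dx <-]; rewrite /= quot_funE //; exists (f x) => //; exact: v_cod.
- move=> _ _ /set_mem [x Dx <-] /set_mem [y Dy <-].
  by rewrite !quot_funE // => /viso_quot; exact.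
- move=> _ [_ /v_surj[x Dx <-] <-].
  by exists (pi x); [exists x|exact: quot_funE].
Qed.

Definition quot_viso f : viso (quotg K) := Viso (quot_image_fin (vdom_fin f))
  (quot_image_fin (vcod_fin f)) (@quot_visoM f) (quot_viso_bij f).

Lemma veq_quot f g : veq f g -> veq (quot_viso f) (quot_viso g).
Proof.
move=> [L [fL LD E]]; exists (quot_image L); split; first exact: quot_image_fin.
  by move=> _ [x /LD [fx gx] <-]; split; exists x.
move=> _ [x Lx <-] /=; have [fx gx] := LD _ Lx.
by rewrite !quot_funE // E.
Qed.

Definition comm_quot (c : Comm G) : Comm (quotg K) :=
  comm_class (quot_viso (comm_repr c)).

Lemma comm_quotE f : comm_quot (comm_class f) = comm_class (quot_viso f).
Proof. by apply/comm_classP/veq_quot; exact: veq_repr. Qed.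

Lemma comm_quotM : {morph comm_quot : c d / c * d}.
Proof.
move=> c d; rewrite -(comm_reprK c) -(comm_reprK d).
set f := comm_repr c; set g := comm_repr d.
rewrite comm_classM !comm_quotE comm_classM; apply/comm_classP.
exists (quot_image (vdom (vcomp f g))); split.
- exact/quot_image_fin/vdom_fin.
- move=> _ [x [gx fx] <-]; split; first by exists x.
  by split; [exists x|rewrite /= quot_funE //; exists (g x)].
- by move=> _ [x [gx fx] <-] /=; rewrite !quot_funE.
Qed.

HB.instance Definition _ :=
  isMultiplicative.Build (Comm G) (Comm (quotg K)) comm_quot comm_quotM.

End CommQuotient.

(* Main.v *)
(* K_G is the FC-centre of G: the elements whose centralizer has finite index. *)
(* A finite conjugation-closed set X such that the (m+1)-st power of each      *)
(* element is a product of at most m elements of X generates a finite group.   *)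
(* This gives Dietzmann's lemma (X torsion) and Schur's theorem (X the         *)
(* commutators of a centre-by-finite group), so the torsion elements of K_G    *)
(* form a locally finite normal subgroup of G containing K_G'.                 *)
(* Every element of K_G has a central power, so K_G / Z(K_G) is a torsion      *)
(* FC-group, hence locally finite.  In an FC-group normal closures of elements *)
(* are finitely generated, so by Fitting's theorem the elements lying in some  *)
(* nilpotent normal subgroup form the Hirsch-Plotkin radical.                  *)
(* In (3), automorphisms fixing pointwise a normal subgroup H of finite index  *)
(* move each generator g within the finite coset g C_G(H).                     *)

Require Import Defs.
From mathcomp Require Import all_boot all_classical.

Set Implicit Arguments.
Unset Strict Implicit.
Unset Printing Implicit Defensive.

Local Open Scope classical_set_scope.
Local Open Scope group_scope.

(** K_G consists of the elements with finitely many conjugates ([conj_kernel_class],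
    [class_conj_kernel]). Dietzmann's lemma ([finite_generated_torsion]) and Schur's theorem
    ([finite_commutators]) make its torsion elements a locally finite normal subgroup T of G,
    [conj_torsion], with K_G/T abelian. Hence K_G' is locally finite; if T is trivial then K_G is
    torsion-free abelian; and K_G is always elementary amenable.

    K_G is moreover an FC-group. Its Fitting subgroup is therefore its Hirsch-Plotkin radical
    ([hirsch_plotkin_radical]), and this contains the centre, modulo which K_G is torsion.

    In (3), a finite subset of K_G centralizes a normal subgroup H of finite index, so it lies in
    the finite group C_G(H). Finitely many elements of K_aut(G) fix such an H pointwise, and only
    finitely many automorphisms do ([finite_aut_fix]).

    In (4), K_G is finite because it is elementary amenable, and it contains every finite normal
    subgroup because conjugacy classes there are finite. If f and g agree modulo K_G, then f(x)^-1
    g(x) is a homomorphism to K_G on a subgroup of finite index, and f = g on its kernel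
    ([comm_quot_inj]). *)

(** * Subgroups of finite index *)

Section FiniteIndexExtra.
Variable G : groupType.
Implicit Types (H L : subgroup G) (x y : G).

(** The elements t u(v) represent all cosets of [H], where t runs over coset representatives of [L]
    and u(v) is a chosen point of [L] with value v under [d]. *)
Lemma finite_index_fibers (T : choiceType) L H (d : G -> T) :
    finite_index L -> finite_set [set d x | x in L] ->
    (forall x y, L x -> L y -> d x = d y -> H (x^-1 * y)) ->
  finite_index H.
Proof.
move=> /finite_indexP[s Hs] /finite_seqP[r Hr] dH; apply/finite_indexP.
pose u v := xget 1 [set l | L l /\ d l = v].
exists [seq t * u v | t <- s, v <- r] => x.
have [t st Lx] := Hs x; set l := t^-1 * x in Lx.
have rl : d l \in r.
  have : [set d x | x in L] (d l) by exists l.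
  by rewrite Hr.
exists (t * u (d l)); first exact: allpairs_f.
have [Lu du] : L (u (d l)) /\ d (u (d l)) = d l.
  by apply: (@xgetPex _ 1 [set l' | L l' /\ d l' = d l]); exists l.
by rewrite invgM -mulgA; apply: dH.
Qed.

Lemma finite_index_repr H : finite_index H ->
  exists (s : seq G) (r : G -> G), forall x, r x \in s /\ H ((r x)^-1 * x).
Proof.
move=> /finite_indexP[s Hs]; exists s.
have [|r Hr] := @boolp.choice _ _ (fun x t => t \in s /\ H (t^-1 * x)); last by exists r.
by move=> x; have [t st Ht] := Hs x; exists t.
Qed.

Lemma finite_image_cosets (T : choiceType) H (d : G -> T) : finite_index H ->
  (forall x y, H (x^-1 * y) -> d x = d y) -> finite_set [set d x | x in [set: G]].
Proof.
move=> /finite_indexP[s Hs] dH.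
apply: (@sub_finite_set _ _ [set d x | x in [set` s]]); last first.
  exact/finite_image/finite_seq.
by move=> _ [x _ <-]; have [t st /dH dt] := Hs x; exists t.
Qed.

Lemma finite_index_bigI (T : eqType) (s : seq T) (P : T -> G -> Prop) :
    (forall t, t \in s -> exists2 L, finite_index L & forall x, L x -> P t x) ->
  exists2 L, finite_index L & forall x, L x -> forall t, t \in s -> P t x.
Proof.
elim: s => [|t s IH] sP; first by exists (subgT G); first exact: finite_indexT.
have [L fL LP] := sP t (mem_head _ _).
have [|M fM MP] := IH; first by move=> u us; apply: sP; rewrite inE us orbT.
exists (subgI L M); first exact: finite_indexI.
by move=> x [/LP Lx /MP Mx] u; rewrite inE => /orP[/eqP->|/Mx].
Qed.

End FiniteIndexExtra.

(** * Images, preimages and generated subgroups *)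

Section Morphisms.
Variables (A B : groupType) (f : UMagmaMorphism.type A B).

Lemma morph_image_proof (H : subgroup A) : is_subgroup [set f x | x in H].
Proof.
split; first by exists 1; [exact: sg1|exact: gmulf1].
- by move=> _ _ [x Hx <-] [y Hy <-]; exists (x * y); [exact: sgM|exact: gmulfM].
- by move=> _ [x Hx <-]; exists x^-1; [exact: sgV|exact: gmulfV].
Qed.
Definition morph_image H := Subgroup (morph_image_proof H).

Lemma morph_preim_proof (H : subgroup B) : is_subgroup (f @^-1` H).
Proof.
split; first by rewrite /= gmulf1; exact: sg1.
- by move=> x y /= Hx Hy; rewrite gmulfM; exact: sgM.
- by move=> x /= Hx; rewrite gmulfV; exact: sgV.
Qed.
Definition morph_preim H := Subgroup (morph_preim_proof H).

Lemma morph_preim_fin H : finite_index H -> finite_index (morph_preim H).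
Proof.
move=> /finite_index_repr[s [r Hr]].
apply: (@finite_index_fibers _ _ _ _ (fun x => r (f x)) (finite_indexT A)).
  apply: sub_finite_set (finite_seq s).
  by move=> _ [x _ <-]; have [] := Hr (f x).
move=> x y _ _ /= E; rewrite gmulfM gmulfV.
have [_ Hx] := Hr (f x); have [_ Hy] := Hr (f y).
by apply: subg_trans Hy; rewrite -E; exact: subg_sym.
Qed.

Lemma morph_image_fin H : (forall b, exists a, f a = b) ->
  finite_index H -> finite_index (morph_image H).
Proof.
move=> fS /finite_indexP[s Hs]; apply/finite_indexP; exists (map f s) => b.
have [a <-] := fS b; have [t st Ht] := Hs a.
exists (f t); first exact: map_f.
by exists (t^-1 * a) => //; rewrite gmulfM gmulfV.
Qed.

End Morphisms.

Section Generated.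
Variable G : groupType.
Implicit Types (S T : set G) (H : subgroup G).

Lemma sub_generated S : S `<=` generated S.
Proof. by move=> x Sx H; exact. Qed.

Lemma generated_min S H : S `<=` H -> generated S `<=` H.
Proof. by move=> SH x; exact. Qed.

Lemma generated_mono S T : S `<=` T -> generated S `<=` generated T.
Proof. by move=> ST; apply: generated_min => x /ST; exact: sub_generated. Qed.

End Generated.

Lemma generated_image (A B : groupType) (f : UMagmaMorphism.type A B) (S : set A) x :
  generated S x -> generated [set f s | s in S] (f x).
Proof.
apply: (@generated_min _ _ (morph_preim f (generated [set f s | s in S]))) => s Ss.
by apply: sub_generated; exists s.
Qed.

Lemma generatedJ (G : groupType) (S : set G) :
  (forall x y, S x -> S (x ^ y)) ->
  forall x y, generated S x -> generated S (x ^ y).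
Proof.
move=> SJ x y Sx H SH.
have HP : is_subgroup [set z | H (z ^ y)].
  split=> [|a b /= Ha Hb|a /= Ha]; first by rewrite /= conj1g; exact: sg1.
  - by rewrite conjMg; exact: sgM.
  - by rewrite conjVg; exact: sgV.
by apply: (Sx (Subgroup HP)) => z Sz; exact/SH/SJ.
Qed.

Definition generated_nsubgroup (G : groupType) (S : set G)
  (SJ : forall x y, S x -> S (x ^ y)) : nsubgroup G := NSubgroup (generatedJ SJ).

Lemma fg_image (A B : groupType) (f : UMagmaMorphism.type A B) :
  finitely_generated A -> exists S : set B,
    [/\ finite_set S, S `<=` range f & range f `<=` generated S].
Proof.
move=> [S fS gS]; exists [set f s | s in S]; split; first exact: finite_image.
  by move=> _ [s _ <-]; exists s.
by move=> _ [a _ <-]; apply: generated_image; rewrite gS.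
Qed.

Lemma generated_fg (G : groupType) (S : set G) :
  finite_set S -> finitely_generated (generated S).
Proof.
move=> fS; exists [set z : generated S | S (val z)].
  by apply: (finite_preimage _ fS) => x y _ _; exact: val_inj.
apply/seteqP; split=> // z _.
set T := [set z : generated S | S (val z)].
have : morph_image (val : UMagmaMorphism.type (generated S) G) (generated T) (val z).
  have /set_mem := valP z; apply: generated_min => s Ss.
  have gs : s \in sgset (generated S) by apply/mem_set/sub_generated.
  by exists (exist _ s gs) => //; exact: sub_generated.
by move=> [w gw /val_inj <-].
Qed.

Lemma finite_group_inj (A B : groupType) (f : A -> B) (S : set B) :
  injective f -> finite_set S -> (forall a, S (f a)) -> finite_group A.
Proof.
move=> fI fS fA; apply: (@sub_finite_set _ _ (f @^-1` S)) => [a _|]; first exact: fA.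
by apply: (finite_preimage _ fS) => x y _ _; exact: fI.
Qed.

(** Moves the test for local finiteness from nested subgroup types to finite subsets of one ambient
    group. *)
Lemma locally_finite_inj (A B : groupType) (f : UMagmaMorphism.type A B) (T : set B) :
    injective f -> (forall a, T (f a)) ->
    (forall S, finite_set S -> S `<=` T -> finite_set (generated S)) ->
  locally_finite A.
Proof.
move=> fI fT Tfin H /(fg_image (f \o val)) [S [fS SH gS]].
have ST : S `<=` T by move=> _ /SH [h _ <-]; exact: fT.
apply: (@finite_group_inj _ _ (f \o val) (generated S)).
- exact: inj_comp fI val_inj.
- exact: Tfin.
- by move=> a; apply/gS; exists a.
Qed.

(** * Finite groups from bounded products *)

Lemma count_leq_size_mul (T : eqType) (X w : seq T) m :
  (forall x, x \in X -> (count_mem x w <= m)%N) -> (count (mem X) w <= size X * m)%N.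
Proof.
elim: X => [|x X IH] cw; first by rewrite (eq_count (a2 := pred0)) ?count_pred0.
rewrite (eq_count (a2 := predU (pred1 x) (mem X))); last by move=> y; rewrite /= inE.
apply: (@leq_trans (count_mem x w + count (mem X) w)); first by rewrite -count_predUI leq_addr.
rewrite mulSn leq_add ?cw ?mem_head //; apply: IH => y Xy.
by apply: cw; rewrite inE Xy orbT.
Qed.

Section BoundedProducts.
Variables (G : groupType) (X : seq G) (m : nat).
Hypothesis XJ : forall x y, x \in X -> y \in X -> x ^ y \in X.
Hypothesis Xred : forall x, x \in X -> exists w : seq G,
  [/\ {subset w <= X}, (size w <= m)%N & x ^+ m.+1 = \prod_(y <- w) y].
Hypothesis XV : forall x, x \in X -> exists w : seq G,
  {subset w <= X} /\ x^-1 = \prod_(y <- w) y.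

(** Moving copies of [x] to the front conjugates the letters that they pass by powers of [x]; these
    stay in [X], and the length is preserved. *)
Lemma extract_power (x : G) k (w : seq G) :
    x \in X -> {subset w <= X} -> (k <= count_mem x w)%N ->
  exists w' : seq G, [/\ {subset w' <= X}, size w = (size w' + k)%N &
    \prod_(y <- w) y = x ^+ k * \prod_(y <- w') y].
Proof.
move=> Xx; elim: w k => [|z w IH] [|k] wX.
- by exists [::]; rewrite big_nil expg0 mulg1.
- by [].
- by move=> _; exists (z :: w); rewrite addn0 expg0 mul1g.
have Xz : z \in X by apply: wX; exact: mem_head.
have {}wX : {subset w <= X} by move=> y wy; apply: wX; rewrite inE wy orbT.
rewrite /=; have [Ezx|nzx] := eqVneq z x.
  rewrite add1n ltnS => kw; have [w' [w'X sw E]] := IH _ wX kw.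
  by exists w'; rewrite big_cons E expgS mulgA sw addnS Ezx.
rewrite add0n => kw; have [w' [w'X sw E]] := IH _ wX kw.
exists (z ^ (x ^+ k.+1) :: w'); split.
- move=> y; rewrite inE => /orP[/eqP->|/w'X //].
  elim: k.+1 => [|n]; first by rewrite expg0 conjg1.
  by rewrite expgSr conjgM => Xn; exact: XJ.
- by rewrite /= sw.
- by rewrite !big_cons E [RHS]mulgA -conjgC -mulgA.
Qed.

(* A word of length > m|X| repeats some letter x more than m times; m + 1 of   *)
(* these can be moved to the front and replaced by a shorter word.             *)
Lemma shorten_product (w : seq G) : {subset w <= X} ->
  exists w' : seq G, [/\ {subset w' <= X}, (size w' <= size X * m)%N &
    \prod_(y <- w) y = \prod_(y <- w') y].
Proof.
have [n] := ubnP (size w); elim: n w => // n IH w; rewrite ltnS => sw wX.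
have [small|big] := leqP (size w) (size X * m); first by exists w.
have [x Xx cx] : exists2 x, x \in X & (m.+1 <= count_mem x w)%N.
  apply/hasP/negPn; rewrite -all_predC; apply/allP => H.
  suff: (size w <= size X * m)%N by rewrite leqNgt big.
  have wE : count (mem X) w = size w by apply/eqP; rewrite -all_count; apply/allP.
  rewrite -wE; apply: count_leq_size_mul => x /H /=; by rewrite -leqNgt.
have [u [uX su ->]] := extract_power Xx wX cx.
have [v [vX sv ->]] := Xred Xx.
rewrite -big_cat; apply: IH.
  rewrite size_cat; apply: leq_trans sw; rewrite su addnC addnS ltnS.
  by rewrite leq_add2l.
by move=> y; rewrite mem_cat => /orP[/vX|/uX].
Qed.

Lemma finite_products n :
  finite_set [set \prod_(y <- w) y | w in [set w : seq G | {subset w <= X} /\ (size w <= n)%N]].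
Proof.
elim: n => [|n IH].
  apply: (@sub_finite_set _ _ [set 1]); last exact: finite_set1.
  by move=> _ [[|x w] [_ sw] <-] //; rewrite big_nil.
pose P := [set \prod_(y <- w) y | w in [set w : seq G | {subset w <= X} /\ (size w <= n)%N]].
apply: (@sub_finite_set _ _ ([set 1] `|` [set x * y | x in [set` X] & y in P])).
  move=> _ [[|x w] [wX sw] <-]; first by left; rewrite big_nil.
  right; exists x; first by apply: wX; exact: mem_head.
  exists (\prod_(y <- w) y); last by rewrite big_cons.
  by exists w => //; split=> // y wy; apply: wX; rewrite inE wy orbT.
by rewrite finite_setU; split; [exact: finite_set1|apply: finite_image2 => //; exact: finite_seq].
Qed.

(** By [XV] the products of words in [X] form a subgroup, and [shorten_product] bounds the length of
    the words needed. *)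
Lemma finite_generated_seq : finite_set (generated [set` X]).
Proof.
apply: sub_finite_set (finite_products (size X * m)).
have PP : is_subgroup [set x | exists2 w : seq G, {subset w <= X} & \prod_(y <- w) y = x].
  split; first by exists [::]; rewrite ?big_nil.
  - move=> _ _ [u uX <-] [v vX <-]; exists (u ++ v); last by rewrite big_cat.
    by move=> y; rewrite mem_cat => /orP[/uX|/vX].
  - move=> _ [w wX <-]; elim: w wX => [|x w IH] wX.
      by exists [::]; rewrite // big_nil invg1.
    have [|u uX E] := IH; first by move=> y wy; apply: wX; rewrite inE wy orbT.
    have [|v [vX E']] := XV (x := x); first by apply: wX; exact: mem_head.
    exists (u ++ v); last by rewrite big_cat big_cons E -E' invgM.
    by move=> y; rewrite mem_cat => /orP[/uX|/vX].
have sX : [set` X] `<=` Subgroup PP.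
  move=> x Xx; exists [:: x]; last by rewrite big_seq1.
  by move=> y; rewrite inE => /eqP->.
move=> x /(generated_min sX) [w wX <-].
by have [w' [w'X sw ->]] := shorten_product wX; exists w'.
Qed.

End BoundedProducts.

(** * Torsion and exponents *)

Lemma pigeonhole (T : eqType) (f : nat -> T) (s : seq T) :
  (forall i, f i \in s) -> exists i j, [/\ (i < j)%N, (j <= size s)%N & f i = f j].
Proof.
move=> fs; have /(uniqPn (f 0)) [i [j [ij js E]]] : ~~ uniq (map f (iota 0 (size s).+1)).
  apply/negP => /uniq_leq_size H.
  have /H : {subset map f (iota 0 (size s).+1) <= s} by move=> _ /mapP[i _ ->].
  by rewrite size_map size_iota ltnn.
rewrite size_map size_iota in js; have li := ltn_trans ij js.
by rewrite !(nth_map 0%N) ?size_iota // !nth_iota // in E; exists i, j.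
Qed.

Section Torsion.
Variable G : groupType.
Implicit Types (S : set G) (H L : subgroup G) (x y g : G).

Definition torsion x := exists n, x ^+ n.+1 = 1.

Lemma torsionJ x g : torsion x -> torsion (x ^ g).
Proof. by move=> [n xn]; exists n; rewrite -conjXg xn conj1g. Qed.

Lemma sgX H x n : H x -> H (x ^+ n).
Proof.
by move=> Hx; elim: n => [|n IH]; [rewrite expg0; exact: sg1|rewrite expgS; exact: sgM].
Qed.

Lemma sgJ H x y : H x -> H y -> H (x ^ y).
Proof. by move=> Hx Hy; apply: sgM; [exact: sgV|exact: sgM]. Qed.

Lemma sgR H x y : H x -> H y -> H [~ x, y].
Proof. by move=> Hx Hy; apply: sgM; [exact: sgV|exact: sgJ]. Qed.

Lemma torsion_finite H x : finite_set H -> H x -> torsion x.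
Proof.
move=> /finite_seqP[s Hs] Hx.
have xs i : x ^+ i \in s by have : sgset H (x ^+ i) by [exact: sgX]; rewrite Hs.
have [i [j [ij _ E]]] := pigeonhole xs; exists (j - i).-1.
by rewrite prednK ?subn_gt0 // expgnFr ?E ?mulgV // ltnW.
Qed.

(** Two of the powers x^0, ..., x^|s| share a coset, so x^d lies in [H] for some d with 1 <= d <=
    |s|; the factorial of |s| is a multiple of every such d, whatever [x] is. *)
Lemma finite_index_exponent H : finite_index H -> exists n, forall x, H (x ^+ n.+1).
Proof.
move=> /finite_index_repr[s [r Hr]]; exists ((size s)`!).-1 => x.
rewrite prednK ?fact_gt0 //.
have rs i : r (x ^+ i) \in s by have [] := Hr (x ^+ i).
have [i [j [ij js E]]] := pigeonhole rs.
have Hd : H (x ^+ (j - i)).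
  have [_ Hi] := Hr (x ^+ i); have [_ Hj] := Hr (x ^+ j).
  have := subg_trans (subg_sym Hi) _; rewrite E => /(_ _ Hj).
  by rewrite -{1}(subnKC (ltnW ij)) expgnDr mulKg.
have /dvdnP[k ->] : (j - i %| (size s)`!)%N.
  by rewrite dvdn_fact // subn_gt0 ij (leq_trans (leq_subr _ _)).
by rewrite mulnC expgnA; exact: sgX.
Qed.

Lemma common_exponent (s : seq G) : (forall x, x \in s -> torsion x) ->
  exists n, forall x, x \in s -> x ^+ n.+1 = 1.
Proof.
elim: s => [|x s IH] sT; first by exists 0%N.
have [n xn] := sT x (mem_head _ _).
have [|m sm] := IH; first by move=> y ys; apply: sT; rewrite inE ys orbT.
exists (n.+1 * m.+1).-1 => y; rewrite prednK ?muln_gt0 // inE => /orP[/eqP->|/sm ym].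
  by rewrite expgnA xn expg1n.
by rewrite mulnC expgnA ym expg1n.
Qed.

End Torsion.

(** * The FC-centre: the theorems of Dietzmann and Schur *)

Section FCCentre.
Variable G : groupType.
Implicit Types (S : set G) (H L : subgroup G) (x y g : G).

Lemma conj_kernel_class x : conj_kernel G x -> finite_set [set x ^ g | g in [set: G]].
Proof.
move=> /conj_kernelP[L fL cL].
(* The inverse makes the conjugate constant on the left cosets of [L]. *)
apply: sub_finite_set (finite_image_cosets (d := fun g => x ^ g^-1) fL _).
  by move=> _ [g _ <-]; exists g^-1; rewrite ?invgK.
move=> g h /cL E; apply: (@conjg_inj _ h); rewrite conjgKV -conjgM.
by rewrite /conjg E mulKg.
Qed.

Lemma class_conj_kernel x : finite_set [set x ^ g | g in [set: G]] -> conj_kernel G x.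
Proof.
move=> fx; apply/conj_kernelP; exists (centralizer [set x]); last first.
  by move=> y /(_ x erefl)/commute_sym.
apply: (@finite_index_fibers _ _ _ _ (fun g => x ^ g^-1) (finite_indexT G)).
  by apply: sub_finite_set fx => _ [g _ <-]; exists g^-1.
move=> g h _ _ E _ ->; apply: commute_sym; apply/commgP/conjg_fixP.
by rewrite conjgM E conjgKV.
Qed.

Lemma centralizer_fin S : finite_set S -> S `<=` conj_kernel G ->
  finite_index (centralizer S).
Proof.
move=> /finite_seqP[s ->] sK.
have [|L fL Ls] := @finite_index_bigI G _ s (fun t x => commute x t).
  by move=> t /sK/conj_kernelP[L fL cL]; exists L => // x /cL/commute_sym.
by apply: finite_indexS fL => x Lx y; exact: Ls.
Qed.

Lemma centralizer_generated S : centralizer S `<=` centralizer (generated S).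
Proof.
move=> x Sx y /(_ (centralizer [set x])) Sy; apply: commute_sym; apply: Sy => //.
by move=> z Sz _ ->; apply: commute_sym; exact: Sx.
Qed.

(* Dietzmann's lemma. *)
Lemma finite_generated_torsion S : finite_set S -> S `<=` conj_kernel G ->
  (forall x, S x -> torsion x) -> finite_set (generated S).
Proof.
move=> fS SK ST.
pose X := \bigcup_(x in S) [set x ^ g | g in [set: G]].
have /finite_seqP[s Xs] : finite_set X.
  by apply: bigcup_finite => // x /SK; exact: conj_kernel_class.
have sX x : x \in s <-> X x by rewrite Xs.
have [|n sn] := @common_exponent _ s.
  by move=> x /sX[y Sy [g _ <-]]; apply/torsionJ/ST.
apply: sub_finite_set (@finite_generated_seq _ s n _ _ _).
- apply: generated_mono => x Sx; apply/sX; exists x => //; exists 1 => //; exact: conjg1.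
- move=> x y /sX[z Sz [g _ <-]] _; apply/sX; exists z => //.
  by exists (g * y); rewrite ?conjgM.
- by move=> x /sn ->; exists [::]; rewrite big_nil.
- move=> x sx; exists (nseq n x); split; first by move=> y /nseqP[->].
  by apply: (mulgI x); rewrite mulgV big_nseq iter_mulg_1 -expgS sn.
Qed.

(** With c = [x, y], one has [x, y^2] = c c^y, and conjugation by y fixes c^(n+1); so c^(n+2) = c
    (c^(n+1))^y = c c^y (c^y)^n. *)
Lemma expg_commg_short x y n : commute y ([~ x, y] ^+ n.+1) ->
  [~ x, y] ^+ n.+2 = [~ x, y ^+ 2] * ([~ x, y] ^ y) ^+ n.
Proof.
set c := [~ x, y] => cy.
have -> : [~ x, y ^+ 2] = c * c ^ y.
  by rewrite expg2 /c !commgEl conjgM (conjMg x^-1 (x ^ y)) conjVg -[RHS]mulgA mulVKg.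
rewrite -conjXg -mulgA -conjMg -expgS.
by rewrite /conjg -cy mulKg expgS.
Qed.

(* Schur's theorem: if the (n+1)-st power of every commutator is central, then *)
(* [expg_commg_short] writes its (n+2)-nd power with n+1 commutators.          *)
Lemma finite_commutators H : finite_index (centralizer H) ->
  finite_set (generated [set [~ x, y] | x in H & y in H]).
Proof.
move=> fC; set X := [set [~ x, y] | x in H & y in H].
(* A commutator in [H] depends only on the cosets of its entries modulo the centralizer of [H], so
   there are finitely many. *)
have cE x x' y : H x -> H x' -> H y -> centralizer H (x^-1 * x') -> [~ x, y] = [~ x', y].
  move=> Hx Hx' Hy cx; rewrite -(mulVKg x x'); move: (x^-1 * x') cx => c cH.
  have cy : c ^ y = c by apply/conjg_fixP/commgP/cH.
  have cR : commute c [~ x, y] by apply: cH; exact: sgR.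
  by rewrite [RHS]commgEl conjMg cy invgM -mulgA [x^-1 * _]mulgA -commgEl -cR mulKg.
have [s [r rP]] := finite_index_repr fC.
have fX : finite_set X.
  pose u a b := xget 1 [set [~ x, y] | x in H `&` [set x | r x = a] & y in H `&` [set y | r y = b]].
  apply: sub_finite_set (finite_image2 u (finite_seq s) (finite_seq s)).
  move=> _ [x Hx [y Hy <-]]; exists (r x); first by have [] := rP x.
  exists (r y); first by have [] := rP y.
  rewrite /u; case: xgetP => [_ -> [x' [Hx' rx] [y' [Hy' ry] <-]]|/(_ [~ x, y])]; last first.
    by case; exists x => //; exists y.
  have C z z' : r z' = r z -> centralizer H (z'^-1 * z).
    by move=> E; have [_ A] := rP z; have [_ B] := rP z'; apply: subg_trans A; rewrite -E; exact: subg_sym.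
  by rewrite (cE x' x y') //; [|exact: C]; rewrite -invgR (cE y' y x) ?invgR //; exact: C.
have [n cn] := finite_index_exponent fC.
have /finite_seqP[t Xt] := fX.
have tX x : x \in t <-> X x by rewrite Xt.
rewrite Xt; apply: (@finite_generated_seq _ t n.+1).
- move=> _ z /tX[x Hx [y Hy <-]] /tX[a Ha [b Hb <-]]; apply/tX.
  have Hc : H [~ a, b] by exact: sgR.
  by rewrite conjRg; exists (x ^ [~ a, b]); last exists (y ^ [~ a, b]) => //; exact: sgJ.
- move=> _ /tX[x Hx [y Hy <-]].
  exists ([~ x, y ^+ 2] :: nseq n ([~ x, y] ^ y)); split.
  + move=> z; rewrite inE => /orP[/eqP->|/nseqP[-> _]]; apply/tX.
      by exists x => //; exists (y ^+ 2) => //; exact: sgX.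
    by rewrite conjRg; exists (x ^ y); last exists (y ^ y) => //; exact: sgJ.
  + by rewrite /= size_nseq.
  + rewrite big_cons big_nseq iter_mulg_1; apply: expg_commg_short.
    by apply: commute_sym; apply: cn.
- move=> _ /tX[x Hx [y Hy <-]]; exists [:: [~ y, x]]; rewrite big_seq1 invgR; split=> //.
  by move=> z; rewrite inE => /eqP->; apply/tX; exists y => //; exists x.
Qed.

(** The centralizer of the subgroup generated by x and y has finite index, so Schur's theorem puts
    [x, y] in a finite group. *)
Lemma torsion_commg x y : conj_kernel G x -> conj_kernel G y -> torsion [~ x, y].
Proof.
move=> Kx Ky; pose S := [set z | z = x \/ z = y].
have fC : finite_index (centralizer (generated S)).
  apply: finite_indexS (@centralizer_generated S) _; apply: centralizer_fin.
    by apply: sub_finite_set (finite_seq [:: x; y]) => z [] ->; rewrite /= !inE eqxx ?orbT.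
  by move=> z [] ->.
apply: torsion_finite (finite_commutators fC) _; apply: sub_generated.
by exists x; [|exists y]; rewrite //; apply: sub_generated; [left|right].
Qed.

(** For products: by Dietzmann's lemma the two factors generate a finite group. *)
Lemma conj_torsion_proof : is_subgroup [set x | conj_kernel G x /\ torsion x].
Proof.
split; first by split; [exact: sg1|exists 0%N].
- move=> x y [Kx Tx] [Ky Ty]; split; first exact: sgM.
  pose S := [set z | z = x \/ z = y].
  have fS : finite_set (generated S).
    apply: finite_generated_torsion => [|z [] ->|z [] ->] //.
    by apply: sub_finite_set (finite_seq [:: x; y]) => z [] ->; rewrite /= !inE eqxx ?orbT.
  by apply: torsion_finite fS _; apply: sgM; apply: sub_generated; [left|right].
- by move=> x [Kx [n xn]]; split; [exact: sgV|exists n; rewrite expVgn xn invg1].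
Qed.

Lemma conj_torsionJ x y : Subgroup conj_torsion_proof x -> Subgroup conj_torsion_proof (x ^ y).
Proof. by move=> [Kx Tx]; split; [exact: nsubgJ|exact: torsionJ]. Qed.

Definition conj_torsion : nsubgroup G := NSubgroup conj_torsionJ.

Lemma conj_torsion_generated S : finite_set S -> S `<=` conj_torsion ->
  finite_set (generated S).
Proof. by move=> fS ST; apply: finite_generated_torsion => // x /ST[]. Qed.

End FCCentre.

Lemma conj_torsion_commg (G : groupType) (x y : G) :
  conj_kernel G x -> conj_kernel G y -> conj_torsion G [~ x, y].
Proof. by move=> Kx Ky; split; [exact: sgR|exact: torsion_commg]. Qed.

(** K_G is an FC-group: a finite-index subgroup of G centralizing z meets K_G in one of finite index
    in K_G. *)
Lemma conj_kernel_sub (G : groupType) (z : conj_kernel G) : conj_kernel (conj_kernel G) z.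
Proof.
have /set_mem/conj_kernelP[L fL cL] := valP z; apply/conj_kernelP.
exists (morph_preim (val : UMagmaMorphism.type (conj_kernel G) G) L); first exact: morph_preim_fin.
by move=> y /cL E; apply: val_inj; rewrite !gmulfM.
Qed.

Lemma derived_conj_kernel_torsion (G : groupType) (z : conj_kernel G) :
  derived (conj_kernel G) z -> conj_torsion G (val z).
Proof.
apply: (@generated_min _ _ (morph_preim (val : UMagmaMorphism.type (conj_kernel G) G) (conj_torsion G))).
move=> _ [x [y ->]]; have /set_mem Kx := valP x; have /set_mem Ky := valP y.
rewrite -[_ _]/(conj_torsion G (val [~ x, y])) gmulfR; exact: conj_torsion_commg.
Qed.

Lemma locally_finite_derived (G : groupType) : locally_finite (derived (conj_kernel G)).
Proof.
apply: (@locally_finite_inj _ _ (val \o val) (conj_torsion G)).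
- exact: inj_comp val_inj val_inj.
- by move=> z; apply: derived_conj_kernel_torsion; exact/set_mem/valP.
- exact: conj_torsion_generated.
Qed.

Lemma locally_finite_torsion (G : groupType) : locally_finite (conj_torsion G).
Proof.
apply: (@locally_finite_inj _ _ val (conj_torsion G)); first exact: val_inj.
- by move=> z; exact/set_mem/valP.
- exact: conj_torsion_generated.
Qed.

(** * Central powers and torsion quotients of FC-groups *)

Section FCGroup.
Variable K : groupType.
Hypothesis KFC : forall x : K, conj_kernel K x.

(** Let [s] represent the cosets of C(x). The centralizer of [s] has finite index, so it contains a
    power of x; this power commutes with both [s] and C(x), hence with K. *)
Lemma central_power (x : K) : exists n, centralizer [set: K] (x ^+ n.+1).
Proof.
have fx : finite_index (centralizer [set x]).
  by apply: centralizer_fin => // ; exact: finite_set1.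
have /finite_indexP[s Hs] := fx.
have fs : finite_index (centralizer [set` s]) by apply: centralizer_fin => //; exact: finite_seq.
have [n xn] := finite_index_exponent fs; exists n => y _.
have [t st cy] := Hs y; rewrite -(mulVKg t y); apply: commuteM; first exact: xn.
by apply: commute_sym; apply: commuteX; exact: cy.
Qed.

Lemma locally_finite_quotient (Q : groupType) (f : UMagmaMorphism.type K Q) :
  (forall q, exists x, f x = q) -> (forall q : Q, torsion q) -> locally_finite Q.
Proof.
move=> fS tQ; have QFC q : conj_kernel Q q.
  have [x <-] := fS q; have /conj_kernelP[L fL cL] := KFC x; apply/conj_kernelP.
  exists (morph_image f L); first exact: morph_image_fin.
  by move=> _ [y /cL E <-]; rewrite /commute -!gmulfM E.
apply: (@locally_finite_inj _ _ idfun setT) => // S fS' _.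
exact: finite_generated_torsion.
Qed.
End FCGroup.

(** * Lower central series and Fitting's theorem *)

Section LowerCentralSeries.
Variable G : groupType.
Implicit Types (H K : subgroup G) (M N : nsubgroup G) (x y g : G) (n : nat).

(** Computed inside the ambient group, so that the series of different subgroups can be compared as
    sets; [lower_centralE] links it to [lower_central]. *)
Fixpoint lcs H n : subgroup G :=
  if n is m.+1 then generated [set [~ x, y] | x in lcs H m & y in H] else H.

Definition nil H := exists n, lcs H n `<=` [set 1].

Lemma lcs_mono H K n : H `<=` K -> lcs H n `<=` lcs K n.
Proof.
move=> HK; elim: n => //= n IH; apply: generated_mono => _ [x Hx [y Hy <-]].
by exists x; [exact: IH|exists y => //; exact: HK].
Qed.

Lemma nil_mono H K : H `<=` K -> nil K -> nil H.
Proof. by move=> HK [n nK]; exists n => x /(lcs_mono HK)/nK. Qed.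

Lemma lcsJ N n x g : lcs N n x -> lcs N n (x ^ g).
Proof.
elim: n x g => [|n IH] x g; first exact: nsubgJ.
apply: generatedJ => {}x {}g [a Na [b Nb <-]]; rewrite conjRg.
by exists (a ^ g); [exact: IH|exists (b ^ g) => //; exact: nsubgJ].
Qed.

Lemma lcs_trivial H m n : (m <= n)%N -> lcs H m `<=` [set 1] -> lcs H n `<=` [set 1].
Proof.
move=> /subnK <-; elim: (n - m)%N => // k IH Hm.
(* The kernel of the identity serves as the trivial subgroup. *)
apply: (@generated_min _ _ (Subgroup (@kernel_proof G G idfun))) => _ [x Hx [y _ <-]].
by rewrite (IH Hm x Hx) /= comm1g.
Qed.

Lemma nsub_commg N x y : N x -> N [~ x, y].
Proof. by move=> Nx; rewrite commgEl; apply: sgM; [exact: sgV|exact: nsubgJ]. Qed.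

Lemma commgMl x y z : [~ x * y, z] = [~ x, z] ^ y * [~ y, z].
Proof. by rewrite !commgEl conjMg invgM /conjg !mulgA !(mulgK, mulgVK). Qed.

Lemma commgVl x y : [~ x^-1, y] = [~ x, y]^-1 ^ x^-1.
Proof.
by rewrite [LHS]commgEl invgK (conjVg x y) commgEl [in RHS]invgM invgK (conjgE _ x^-1) invgK mulgK.
Qed.

(** With [commg_closed_r], allows membership of [x, y] in [N] to be checked on generators in either
    entry. *)
Lemma commg_closed_l N y : is_subgroup [set x | N [~ x, y]].
Proof.
split; first by rewrite /= comm1g; exact: sg1.
- by move=> x z /= Nx Nz; rewrite commgMl; apply: sgM => //; exact: nsubgJ.
- by move=> x /= Nx; rewrite commgVl; apply: nsubgJ; exact: sgV.
Qed.

Lemma commg_closed_r N x : is_subgroup [set y | N [~ x, y]].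
Proof.
have [N1 NM NV] := commg_closed_l N x.
have sw y : N [~ x, y] <-> N [~ y, x].
  by split=> /sgV; rewrite invgR.
split; first exact/sw.
- by move=> y z /sw Ny /sw Nz; apply/sw; exact: NM.
- by move=> y /sw Ny; apply/sw; exact: NV.
Qed.

Section Fitting.
Variables M N : nsubgroup G.

(* lcs H is H at index 0; here H has index 1 and the whole group index 0.      *)
Definition lcs_above (H : nsubgroup G) i : set G := if i is j.+1 then lcs H j else [set: G].

Lemma lcs_aboveJ (H : nsubgroup G) i x g : lcs_above H i x -> lcs_above H i (x ^ g).
Proof. by case: i => //= j; exact: lcsJ. Qed.

Lemma lcs_aboveR (H : nsubgroup G) i x y : lcs_above H i x -> H y -> lcs_above H i.+1 [~ x, y].
Proof.
case: i => [_ Hy|i Hx Hy] /=; first by rewrite -invgR; apply/sgV/nsub_commg.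
by apply: sub_generated; exists x => //; exists y.
Qed.

Lemma lcs_above_normR (H : nsubgroup G) i x y : lcs_above H i x -> lcs_above H i [~ x, y].
Proof.
case: i => //= i Hx; rewrite commgEl; apply: sgM; [exact: sgV|exact: lcsJ].
Qed.

(* These generate a descending central series of MN, whence Fitting's theorem. *)
Definition fitting_gen n : set G :=
  [set x | exists i j, [/\ (i + j)%N = n, lcs_above M i x & lcs_above N j x]].

Lemma fitting_genJ n x g : fitting_gen n x -> fitting_gen n (x ^ g).
Proof.
by move=> [i [j [ij Mx Nx]]]; exists i, j; split=> //; exact: lcs_aboveJ.
Qed.

Definition fitting_series n : nsubgroup G := generated_nsubgroup (@fitting_genJ n).

Definition normal_join_gen : set G := [set x | M x \/ N x].

Lemma normal_join_genJ x g : normal_join_gen x -> normal_join_gen (x ^ g).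
Proof. by move=> [/(nsubgJ g)|/(nsubgJ g)]; [left|right]. Qed.

Definition normal_join : nsubgroup G := generated_nsubgroup normal_join_genJ.

(** On generators, commutation with an element of [M] raises i and keeps j by normality; with an
    element of [N] it raises j and keeps i. *)
Lemma fitting_seriesR n x y :
  fitting_series n x -> normal_join y -> fitting_series n.+1 [~ x, y].
Proof.
move=> Fx; apply: (@generated_min _ _ (Subgroup (commg_closed_r (fitting_series n.+1) x))).
move=> {}y My; move: x Fx.
apply: (@generated_min _ _ (Subgroup (commg_closed_l (fitting_series n.+1) y))).
move=> x [i [j [ij Mx Nx]]]; apply: sub_generated.
case: My => [My|Ny].
  by exists i.+1, j; rewrite addSn ij; split=> //; [exact: lcs_aboveR|exact: lcs_above_normR].
by exists i, j.+1; rewrite addnS ij; split=> //; [exact: lcs_above_normR|exact: lcs_aboveR].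
Qed.

Lemma lcs_normal_join n : lcs normal_join n `<=` fitting_series n.+1.
Proof.
elim: n => [|n IH]; last first.
  by apply: generated_min => _ [x /IH Fx [y Jy <-]]; exact: fitting_seriesR.
apply: generated_mono => x [Mx|Nx]; first by exists 1%N, 0%N.
by exists 0%N, 1%N.
Qed.

Lemma nil_normal_join : nil M -> nil N -> nil normal_join.
Proof.
(* Here i + j = c + d + 2, so i > c or j > d, and the generator is trivial. *)
move=> [c Mc] [d Nd]; exists (c + d).+1 => x /lcs_normal_join.
apply: (@generated_min _ _ (Subgroup (@kernel_proof G G idfun))).
move=> {}x [i [j [ij Mx Nx]]].
have [ci|ic] := ltnP c i.
  by case: i ci ij Mx => // i ci _ Mx; apply: lcs_trivial Mc _ Mx.
case: j ij Nx => [ij|j ij Nx]; first by exfalso; move: ic; rewrite -(addn0 i) ij leqNgt ltnS leqW // leq_addr.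
apply: lcs_trivial Nd _ Nx; rewrite -(leq_add2l c); apply: leq_trans (leq_add ic (leqnn j)).
by move: ij; rewrite addnS => -[->].
Qed.

End Fitting.
End LowerCentralSeries.

(** * Nilpotency along morphisms *)

Section NilpotentImage.
Variables (A B : groupType) (f : UMagmaMorphism.type A B).

Lemma lcs_image_sub H n x : lcs H n x -> lcs (morph_image f H) n (f x).
Proof.
elim: n x => [|n IH] x; first by exists x.
apply: (@generated_min _ _ (morph_preim f (lcs (morph_image f H) n.+1))) => _ [a Ha [b Hb <-]].
apply: sub_generated; exists (f a); first exact: IH.
by exists (f b); [exists b|rewrite gmulfR].
Qed.

Lemma lcs_imageP H n : lcs (morph_image f H) n `<=` morph_image f (lcs H n).
Proof.
elim: n => // n IH; apply: generated_min => _ [_ /IH[a Ha <-] [_ [b Hb <-] <-]].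
exists [~ a, b]; last by rewrite gmulfR.
by apply: sub_generated; exists a => //; exists b.
Qed.

Lemma lower_centralE n : lower_central A n = lcs (subgT A) n :> set A.
Proof.
elim: n => // n IH; apply/seteqP; split; apply: generated_mono.
  by move=> _ [x [y [Hx ->]]]; exists x; [rewrite -IH|exists y].
by move=> _ [x Hx [y _ <-]]; exists x, y; rewrite IH.
Qed.

Lemma nilpotent_inj (S : subgroup B) :
  injective f -> (forall a, S (f a)) -> nil S -> nilpotent A.
Proof.
move=> fI fS [n nS]; exists n; rewrite lower_centralE; apply/seteqP; split=> [x Hx|_ ->]; last exact: sg1.
apply: fI; rewrite gmulf1; apply: nS; apply: lcs_mono (lcs_image_sub Hx).
by move=> _ [a _ <-].
Qed.

Lemma nil_range (S : subgroup B) : nilpotent A -> S `<=` range f -> nil S.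
Proof.
move=> [n nA] Sf; exists n => x Sx.
have /lcs_imageP[a] : lcs (morph_image f (subgT A)) n x by exact: lcs_mono Sx.
by rewrite -lower_centralE nA => -> <-; exact: gmulf1.
Qed.

End NilpotentImage.

(** * The Hirsch-Plotkin radical of an FC-group *)

Section LocallyNilpotent.
Variable K : groupType.

Lemma nil_generated (N : subgroup K) (S : set K) :
  locally_nilpotent N -> finite_set S -> S `<=` N -> nil (generated S).
Proof.
move=> lN fS SN; set S' := [set z : N | S (val z)].
have fS' : finite_set S'.
  by apply: (finite_preimage _ fS) => x y _ _; exact: val_inj.
have nS' := lN _ (generated_fg fS').
apply: (@nil_range _ _ (val \o val : UMagmaMorphism.type (generated S') K)) nS' _.
apply: (@generated_min _ _ (morph_image (val \o val : UMagmaMorphism.type (generated S') K) (subgT _))).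
move=> s Ss; have Ns : s \in sgset N by exact/mem_set/SN.
have gs : (exist _ s Ns : N) \in sgset (generated S') by apply/mem_set/sub_generated.
by exists (exist (fun z => z \in sgset (generated S')) _ gs).
Qed.

Lemma locally_nilpotent_nil (R : subgroup K) :
    (forall S, finite_set S -> S `<=` R -> nil (generated S)) -> locally_nilpotent R.
Proof.
move=> nR H /(fg_image (val \o val)) [S [fS SH gS]].
have SR : S `<=` R by move=> _ /SH[h _ <-]; exact/set_mem/valP.
apply: (@nilpotent_inj _ _ (val \o val) (generated S)).
- exact: inj_comp val_inj val_inj.
- by move=> a; apply/gS; exists a.
- exact: nR.
Qed.

Lemma nil_center : nil (centralizer [set: K]).
Proof.
exists 1%N; apply: (@generated_min _ _ (Subgroup (@kernel_proof K K idfun))).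
by move=> _ [x Hx [y _ <-]]; apply/eqP/commgP/Hx.
Qed.

Lemma centerJ x y : centralizer [set: K] x -> centralizer [set: K] (x ^ y).
Proof. by move=> Zx; rewrite /conjg (Zx y) // mulKg. Qed.

Definition centern : nsubgroup K := NSubgroup centerJ.

(** This is the Fitting subgroup; Fitting's theorem gives closure under products. *)
Lemma hirsch_plotkin_proof : is_subgroup [set x | exists2 N : nsubgroup K, nil N & N x].
Proof.
split; first by exists centern; [exact: nil_center|exact: sg1].
- move=> x y [M nM Mx] [N nN Ny]; exists (normal_join M N); first exact: nil_normal_join.
  by apply: sgM; apply: sub_generated; [left|right].
- by move=> x [N nN Nx]; exists N => //; exact: sgV.
Qed.

Lemma hirsch_plotkinJ x y :
  Subgroup hirsch_plotkin_proof x -> Subgroup hirsch_plotkin_proof (x ^ y).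
Proof. by move=> [N nN Nx]; exists N => //; exact: nsubgJ. Qed.

Definition hirsch_plotkin : nsubgroup K := NSubgroup hirsch_plotkinJ.

(** By Fitting's theorem a finite subset lies in one nilpotent normal subgroup. Conversely, an
    element of a locally nilpotent normal [N] has a finite class inside [N], which generates a
    nilpotent normal subgroup. *)
Lemma hirsch_plotkin_radical : (forall x : K, conj_kernel K x) ->
  is_hirsch_plotkin_radical hirsch_plotkin.
Proof.
move=> KFC; split.
  apply: locally_nilpotent_nil => S /finite_seqP[s ->] sR.
  suff [N nN sN] : exists2 N : nsubgroup K, nil N & forall x, x \in s -> N x.
    by apply: nil_mono nN; apply: generated_min.
  elim: s sR => [|x s IH] sR; first by exists centern; first exact: nil_center.
  have [M nM Mx] := sR x (mem_head _ _).
  have [|N nN sN] := IH; first by move=> y ys; apply: sR; rewrite /= inE ys orbT.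
  exists (normal_join M N); first exact: nil_normal_join.
  by move=> y; rewrite inE => /orP[/eqP->|/sN Ny]; apply: sub_generated; [left|right].
move=> N lN x Nx; pose X := [set x ^ g | g in [set: K]].
have XJ y g : X y -> X (y ^ g) by move=> [h _ <-]; exists (h * g); rewrite ?conjgM.
exists (generated_nsubgroup XJ); last first.
  by apply: sub_generated; exists 1; rewrite ?conjg1.
apply: (nil_generated lN); first exact: conj_kernel_class.
by move=> _ [g _ <-]; exact: nsubgJ.
Qed.

Lemma locally_finite_quotient_radical : (forall x : K, conj_kernel K x) ->
  locally_finite (quotg hirsch_plotkin).
Proof.
move=> KFC; apply: (locally_finite_quotient KFC (f := @quot_proj K hirsch_plotkin)).
  by move=> q; exists (quot_repr q); exact: quot_reprK.
move=> q; have [n Zn] := central_power KFC (quot_repr q); exists n.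
rewrite -(quot_reprK q) -gmulfXn -(gmulf1 (s := @quot_proj K hirsch_plotkin)).
by apply/esym/quot_projP; rewrite invg1 mul1g; exists centern; [exact: nil_center|].
Qed.

End LocallyNilpotent.

(** * Normal cores and finite centralizers *)

Lemma finite_set_injon (T : choiceType) (U : Type) (P : set T) (f : T -> U) :
  (forall x y, P x -> P y -> f x = f y -> x = y) -> finite_set [set f x | x in P] ->
  finite_set P.
Proof.
have [->|/set0P[x0 _]] := eqVneq P set0; first by move=> *; exact: finite_set0.
move=> fI ff; pose g u := xget x0 [set x | P x /\ f x = u].
apply: sub_finite_set (finite_image g ff) => x Px; exists (f x); first by exists x.
have [Pg fg] : [set y | P y /\ f y = f x] (g (f x)).
  by apply: xgetPex; exists x.
exact: fI.
Qed.

Section NormalCore.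
Variables (G : groupType) (L : subgroup G).

Lemma core_proof : is_subgroup [set x | forall g, L (x ^ g)].
Proof.
split=> [g|x y Lx Ly g|x Lx g]; first by rewrite conj1g; exact: sg1.
- by rewrite conjMg; exact: sgM.
- by rewrite conjVg; exact: sgV.
Qed.

Lemma coreJ x y : Subgroup core_proof x -> Subgroup core_proof (x ^ y).
Proof. by move=> Lx g; rewrite -conjgM. Qed.

Definition core : nsubgroup G := NSubgroup coreJ.

Lemma core_sub : core `<=` L.
Proof. by move=> x /(_ 1); rewrite conjg1. Qed.

(** Writing g = t l with l in [L], x^g lies in [L] as soon as x^t does; so finitely many conjugates
    of [L] suffice. *)
Lemma core_fin : finite_index L -> finite_index core.
Proof.
move=> fL; have /finite_indexP[s Hs] := fL.
have [|M fM ML] := @finite_index_bigI G _ s (fun t x => L (x ^ t)).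
  move=> t _; have /finite_indexP[r Hr] := fL.
  have MP : is_subgroup [set x | L (x ^ t)].
    split=> [|x y Lx Ly|x Lx]; rewrite /= ?conj1g ?conjMg ?conjVg; first exact: sg1.
      exact: sgM.
    exact: sgV.
  exists (Subgroup MP) => //; apply/finite_indexP.
  exists [seq u ^ t^-1 | u <- r] => x; have [u ru Lu] := Hr (x ^ t).
  exists (u ^ t^-1); first exact: map_f.
  by rewrite /= conjMg conjVg conjgKV.
apply: finite_indexS fM => x /ML Lx g; have [t st Lt] := Hs g.
by rewrite -(mulVKg t g) conjgM; apply: sgJ => //; exact: Lx.
Qed.

End NormalCore.

Section FiniteCentralizers.
Variable G : groupType.
Hypothesis fC : forall H : nsubgroup G, finite_index H -> finite_set (centralizer H).

Lemma locally_finite_conj_kernel : locally_finite (conj_kernel G).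
Proof.
apply: (@locally_finite_inj _ _ val (conj_kernel G)); first exact: val_inj.
  by move=> z; exact/set_mem/valP.
move=> S fS SK; have fL := core_fin (centralizer_fin fS SK).
apply: sub_finite_set (fC fL); apply: generated_min => x Sx y /core_sub /(_ x Sx).
exact: commute_sym.
Qed.

Lemma aut_kernelP (a : aut G) : aut_kernel G a <->
  exists2 L : subgroup G, finite_index L & forall x, L x -> a x = x.
Proof.
split=> [/comm_classP[L [fL _ E]]|[L fL E]]; first by exists L.
by apply/comm_classP; exists L; split.
Qed.

Lemma aut_fix_proof (H : set G) : is_subgroup [set a : aut G | forall x, H x -> a x = x].
Proof.
split=> // [a b Ha Hb x Hx|a Ha x Hx]; first by rewrite autME Hb // Ha.
by rewrite -{1}(Ha x Hx) -autME mulVg.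
Qed.
Definition aut_fix H := Subgroup (aut_fix_proof H).

(** Applying [a] to (g h g^-1) g = g h, where [a] fixes h and g h g^-1, shows that g^-1 a(g)
    commutes with h. *)
Lemma aut_fix_coset (H : nsubgroup G) (a : aut G) g :
  aut_fix H a -> lcoset g (centralizer H) (a g).
Proof.
move=> aH; apply/lcosetP => h Hh.
have E : h ^ g^-1 * a g = a g * h.
  by rewrite -{1}(aH _ (nsubgJ g^-1 Hh)) -{2}(aH h Hh) -!autM -conjgCV.
by rewrite /commute -mulgA -E conjgE invgK !mulgA mulVg mul1g.
Qed.

Lemma aut_eq_gen (S : set G) (a b : aut G) : generated S = [set: G] :> set G ->
  (forall x, S x -> a x = b x) -> a = b.
Proof.
move=> gS ab; apply: aut_eqP => x.
have EP : is_subgroup [set x | a x = b x].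
  split; first exact: etrans (v1 (aut_viso a)) (esym (v1 (aut_viso b))).
  - by move=> y z /= Ey Ez; rewrite !autM Ey Ez.
  - move=> y Ey; have aV (c : aut G) : c y^-1 = (c y)^-1 by exact: (@vV _ (aut_viso c)).
    by rewrite /= !aV Ey.
have : generated S x by rewrite gS.
exact: (@generated_min _ _ (Subgroup EP)).
Qed.

(** An automorphism is determined by its values on generators, each confined to a finite coset by
    [aut_fix_coset]. *)
Lemma finite_aut_fix (H : nsubgroup G) : finitely_generated G -> finite_index H ->
  finite_set (aut_fix H).
Proof.
move=> [S /finite_seqP[s ->] gS] /fC fCH.
apply: (@finite_set_injon _ _ (aut_fix H) (fun a => [seq a x | x <- s])).
  by move=> a b _ _ /eq_in_map ab; apply: (aut_eq_gen gS).
elim: s {gS} => [|x s IH].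
  by apply: sub_finite_set (finite_set1 [::]) => _ [a _ <-].
apply: sub_finite_set (finite_image2 cons (finite_image (fun c => x * c) fCH) IH).
move=> _ [a Ha <-]; exists (a x); first exact: aut_fix_coset.
by exists [seq a y | y <- s] => //; exists a.
Qed.

Lemma locally_finite_aut_kernel : finitely_generated G -> locally_finite (aut_kernel G).
Proof.
move=> fgG; apply: (@locally_finite_inj _ _ val (aut_kernel G)); first exact: val_inj.
  by move=> z; exact/set_mem/valP.
move=> _ /finite_seqP[s ->] sK.
have [|L fL Ls] := @finite_index_bigI G _ s (fun a x => a x = x).
  by move=> a /sK/aut_kernelP.
apply: sub_finite_set (finite_aut_fix fgG (core_fin fL)).
apply: generated_min => a sa x /core_sub/Ls; exact.
Qed.

End FiniteCentralizers.

(** * Elementary amenability and injectivity on commensurators *)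

Lemma elementary_amenable_locally_finite (G : groupType) :
  locally_finite G -> elementary_amenable G.
Proof.
move=> lfG; apply: (@EA_union G [set H : subgroup G | finitely_generated H]).
- move=> H K /(fg_image val)[S [fS _ HS]] /(fg_image val)[T [fT _ KT]].
  exists (generated (S `|` T)); first by apply: generated_fg; rewrite finite_setU.
  split=> x Hx.
    apply: (@generated_mono _ S); first by left.
    by apply: HS; exists (exist _ x (mem_set Hx)).
  apply: (@generated_mono _ T); first by right.
  by apply: KT; exists (exist _ x (mem_set Hx)).
- move=> x; exists (generated [set x]); last exact: sub_generated.
  exact/generated_fg/finite_set1.
- by move=> H /lfG; exact: EA_finite.
Qed.

(** The torsion subgroup is locally finite, and the quotient by it is abelian since it contains all
    commutators. *)
Lemma elementary_amenable_conj_kernel (G : groupType) : elementary_amenable (conj_kernel G).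
Proof.
pose v : UMagmaMorphism.type (conj_kernel G) G := val.
have TJ x y : morph_preim v (conj_torsion G) x -> morph_preim v (conj_torsion G) (x ^ y).
  by move=> Tx; rewrite -[_ _]/(conj_torsion G (v (x ^ y))) gmulfJ; exact: nsubgJ.
apply: (@EA_ext _ (NSubgroup TJ)).
  apply/elementary_amenable_locally_finite/(@locally_finite_inj _ _ (v \o val) (conj_torsion G)).
  - exact: inj_comp val_inj val_inj.
  - by move=> z; exact: (set_mem (valP z)).
  - exact: conj_torsion_generated.
apply: EA_abelian => p q; rewrite -(quot_reprK p) -(quot_reprK q) /commute -!gmulfM.
apply/quot_projP; set x := quot_repr p; set y := quot_repr q.
have -> : (x * y)^-1 * (y * x) = [~ y, x] by rewrite invgM -mulgA.
rewrite -[_ _]/(conj_torsion G (v [~ y, x])) gmulfR.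
by apply: conj_torsion_commg; [exact: (set_mem (valP y))|exact: (set_mem (valP x))].
Qed.

Lemma finite_nsubgroup_conj_kernel (G : groupType) (N : nsubgroup G) :
  finite_group N -> N `<=` conj_kernel G.
Proof.
move=> fN x Nx; apply: class_conj_kernel; apply: sub_finite_set (finite_image val fN).
by move=> _ [g _ <-]; exists (exist _ (x ^ g) (mem_set (nsubgJ g Nx))).
Qed.

(* On the points of L whose image under f centralises the finite group K,     *)
(* x |-> f(x)^-1 g(x) is a homomorphism to K, and its kernel has finite index. *)
Lemma comm_quot_inj (G : groupType) :
  finite_set (conj_kernel G) -> injective (@comm_quot G).
Proof.
move=> fK c d; rewrite -(comm_reprK c) -(comm_reprK d) !comm_quotE.
move: (comm_repr c) (comm_repr d) => {c d} f g /comm_classP[M [fM _ E]]; apply/comm_classP.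
pose pi := @quot_proj G (conj_kernel G).
pose C := centralizer (conj_kernel G).
have fC : finite_index C by exact: centralizer_fin.
pose L := subgI (subgI (vdom g) (morph_preim pi M)) (vpreim f C).
have fL : finite_index L.
  apply: finite_indexI; last exact: vpreim_fin.
  by apply: finite_indexI; [exact: vdom_fin|exact: morph_preim_fin].
pose D x := (f x)^-1 * g x.
have LD x : L x -> [/\ vdom f x, vdom g x, C (f x) & conj_kernel G (D x)].
  move=> [[gx Mx] [fx Cx]]; split=> //.
  by apply/quot_projP; have := E _ Mx; rewrite /= !quot_funE.
have DM x y : L x -> L y -> D (x * y) = D x * D y.
  move=> /LD[fx gx _ Kx] /LD[fy gy Cy _]; rewrite /D !vM // invgM.
  (* D(xy) = f(y)^-1 D(x) g(y), and f(y)^-1 commutes with D(x), which lies in K_G. *)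
  have /(_ _ Kx) CD := sgV Cy.
  by rewrite mulgA -[(f y)^-1 * _ * _]mulgA CD !mulgA.
have HP : is_subgroup [set x | L x /\ D x = 1].
  split; first by split; [exact: sg1|rewrite /D !v1 invg1 mulg1].
  - by move=> x y [Lx Dx] [Ly Dy]; split; [exact: sgM|rewrite DM // Dx Dy mulg1].
  - move=> x [Lx Dx]; split; first exact: sgV.
    by apply: (mulgI (D x)); rewrite -DM //; [rewrite mulgV Dx /D !v1 invg1 !mulg1|exact: sgV].
have fH : finite_index (Subgroup HP).
  apply: (@finite_index_fibers _ _ _ _ D fL).
    by apply: sub_finite_set fK => _ [x /LD[_ _ _ Kx] <-].
  move=> x y Lx Ly Dxy; split; first by apply: sgM => //; exact: sgV.
  apply: (mulgI (D x)); rewrite -DM //; first by rewrite mulVKg mulg1.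
  by apply: sgM => //; exact: sgV.
exists (Subgroup HP); split=> // [x [/LD[fx gx _ _] _] //|x [_ Dx]].
by rewrite -[RHS](mulVKg (f x)) -/(D x) Dx mulg1.
Qed.

Theorem theorem11 (G : groupType) (hG : finitely_generated G) :
  [/\
  (* (1) *)
    locally_finite (derived (conj_kernel G)) /\
    (exists2 R : nsubgroup (conj_kernel G),
       is_hirsch_plotkin_radical R & locally_finite (quotg R)),
  (* (2) *)
    (forall N : nsubgroup G, locally_finite N -> N = [set 1] :> set G) ->
    torsion_free (conj_kernel G) /\ is_abelian (conj_kernel G),
  (* (3) *)
    (forall H : nsubgroup G, finite_index H -> finite_set (centralizer H)) ->
    locally_finite (conj_kernel G) /\ locally_finite (aut_kernel G)
  & (* (4) *)
    (forall N : nsubgroup G, elementary_amenable N -> finite_group N) ->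
    is_maximal_normal finite_group (conj_kernel G) /\
    injective (@comm_quot G)].
Proof.
have KFC (x : conj_kernel G) : conj_kernel (conj_kernel G) x by exact: conj_kernel_sub.
split.
- split; first exact: locally_finite_derived.
  exists (hirsch_plotkin (conj_kernel G)); first exact: hirsch_plotkin_radical.
  exact: locally_finite_quotient_radical.
(* The torsion subgroup is trivial, and it contains every torsion element and every commutator of
   K_G. *)
- move=> /(_ _ (@locally_finite_torsion G)) T1; split=> [x n xn|x y].
    apply: val_inj; rewrite gmulf1; have : conj_torsion G (val x).
      split; first exact/set_mem/valP.
      by exists n; rewrite -gmulfXn xn gmulf1.
    by rewrite T1.
  apply/commgP/eqP; apply: val_inj; rewrite gmulf1 gmulfR.
  have : conj_torsion G [~ val x, val y] by apply: conj_torsion_commg; exact/set_mem/valP.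
  by rewrite T1.
- by move=> fC; split; [exact: locally_finite_conj_kernel|exact: locally_finite_aut_kernel].
- move=> /(_ _ (@elementary_amenable_conj_kernel G)) fK; split.
    by split=> // N; exact: finite_nsubgroup_conj_kernel.
  apply: comm_quot_inj; apply: sub_finite_set (finite_image val fK) => x Kx.
  by exists (exist _ x (mem_set Kx)).
Qed.
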